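(* Let $(M^6,g,\phi)$ be a (connected) $\mathrm{SU}(3)$-manifold, i.e. a 6-dimensional oriented Riemannian spin manifold with a unit spinor field $\phi$, with Levi-Civita connection $\nabla$, Dirac operator $D$, orthogonal almost complex structure $J=J_\phi$, and put $\eta(X):=(\nabla_X\phi,j(\phi))$, $\lambda:=\frac16(D\phi,j(\phi))$, $\mu:=-\frac16(D\phi,\phi)$. Then the $\mathrm{SU}(3)$-structure is of the indicated class if and only if the corresponding condition holds (for all vectors $X,Y$): - $\chi_1$: $\nabla_X\phi=-\lambda\,X\,j(\phi)$ with $\lambda\in\mathbb{R}$ constant; - $\chi_{\bar1}$: $\nabla_X\phi=\mu\,X\phi$ with $\mu\in\mathbb{R}$ constant; - $\chi_2$: $(JY\,\nabla_X\phi,\phi)=-(Y\,\nabla_{JX}\phi,\phi)$, $(Y\nabla_X\phi,j(\phi))=(X\nabla_Y\phi,j(\phi))$ and $\lambda=0,\ \eta=0$; - $\chi_{\bar2}$: $(JY\,\nabla_X\phi,\phi)=-(Y\,\nabla_{JX}\phi,\phi)$, $(Y\nabla_X\phi,j(\phi))=-(X\nabla_Y\phi,j(\phi))$ and $\mu=0,\ \eta=0$; - $\chi_3$: $(JY\,\nabla_X\phi,\phi)=(Y\,\nabla_{JX}\phi,\phi)$, $(Y\nabla_X\phi,j(\phi))=(X\nabla_Y\phi,j(\phi))$ and $\eta=0$; - $\chi_4$: $(JY\,\nabla_X\phi,\phi)=(Y\,\nabla_{JX}\phi,\phi)$, $(Y\nabla_X\phi,j(\phi))=-(X\nabla_Y\phi,j(\phi))$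 and $\eta=0$; - $\chi_5$: $\nabla_X\phi=(\nabla_X\phi,j(\phi))\,j(\phi)$; - $\chi_{1\bar1}$: $\nabla_X\phi=-\lambda\,X\,j(\phi)+\mu\,X\phi$; - $\chi_{2\bar2}$: $(JY\,\nabla_X\phi,\phi)=-(Y\,\nabla_{JX}\phi,\phi)$, $\lambda=\mu=0$ and $\eta=0$; - $\chi_{2\bar25}$: $(JY\,\nabla_X\phi,\phi)=-(Y\,\nabla_{JX}\phi,\phi)$ and $\lambda=\mu=0$; - $\chi_{1\bar12\bar2}$: $(JY\,\nabla_X\phi,\phi)=-(Y\,\nabla_{JX}\phi,\phi)$ and $\eta=0$; - $\chi_{1\bar12\bar25}$: $(JY\,\nabla_X\phi,\phi)=-(Y\,\nabla_{JX}\phi,\phi)$; - $\chi_{2\bar23}$: $D\phi=0$ and $\eta=0$; - $\chi_{1\bar12\bar23}$: $(D\phi,X\phi)=0$ and $\eta=0$; - $\chi_{1\bar12\bar234}$: $(\nabla_X\phi,j(\phi))=0$; - $\chi_{2\bar235}$: $(D\phi,X\,j(\phi))=\eta(X)$ and $\lambda=\mu=0$; - $\chi_{1\bar12\bar235}$: $(D\phi,X\,j(\phi))=\eta(X)$; - $\chi_{34}$: $(JY\,\nabla_X\phi,\phi)=(Y\,\nabla_{JX}\phi,\phi)$ and $\eta=0$; - $\chi_{345}$: $(JY\,\nabla_X\phi,\phi)=(Y\,\nabla_{JX}\phi,\phi)$; - $\chi_{2\bar2345}$: $\lambda=\mu=0$; - $\chi_{\bar1\bar23}$: $(X\nabla_Y\phi,\phi)=(Y\nabla_X\phi,\phi)$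 and $\eta=0$.
   Context: Conventions. $M^6$ is an oriented Riemannian spin manifold; $\Sigma$ is its real rank-8 spinor bundle, associated with the real 8-dimensional representation $\Delta=\mathbb{R}^8$ of the Clifford algebra of $\mathbb{R}^6$ (with $X^2=-|X|^2$), with inner product $(\cdot,\cdot)$ for which vectors act skew-symmetrically. Clifford multiplication is written by juxtaposition, $X\phi$. $\nabla$ denotes the Levi-Civita connection and its lift to $\Sigma$; $D=\sum_i e_i\nabla_{e_i}$ is the Riemannian Dirac operator. The parallel endomorphism $j:=e_1e_2e_3e_4e_5e_6$ of $\Sigma$ ($e_i$ an oriented orthonormal frame) satisfies $j^2=-1$ and anticommutes with vectors. A unit spinor field $\phi$ defines an $\mathrm{SU}(3)$-structure with orthogonal almost complex structure $J=J_\phi$ given by $(JX)\phi=j(X\phi)$. Pointwise $\Sigma=\mathbb{R}\phi\oplus\mathbb{R}j(\phi)\oplus\{X\phi: X\in TM\}$ (orthogonal), so there are a unique one-form $\eta$ and a unique endomorphism field $S$ of $TM$ with $\nabla_X\phi=\eta(X)j(\phi)+S(X)\phi$. Classes. At each point the pair $(S,\eta)$ lies in the direct sum of the following seven spaces: $\chi_1$: $S\in\mathbb{R}J$, $\eta=0$; $\chi_{\bar1}$: $S\in\mathbb{R}\,\mathrm{Id}$, $\eta=0$; $\chi_2$: $S\in\mathfrak{su}(3)$ (skew, $SJ=JS$, $\mathrm{tr}(JS)=0$), $\eta=0$; $\chi_{\bar2}$: $S$ symmetric traceless with $SJ=JS$, $\eta=0$; $\chi_3$: $S$ symmetric traceless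 with $SJ=-JS$, $\eta=0$; $\chi_4$: $S$ skew with $SJ=-JS$, $\eta=0$; $\chi_5$: $S=0$, $\eta$ arbitrary. Several indices denote direct sums, e.g. $\chi_{1\bar24}=\chi_1\oplus\chi_{\bar2}\oplus\chi_4$. The structure is ''of class $\chi_{\ldots}$'' if $(S,\eta)$ lies in the corresponding sum at every point. *)

(* Defs.v *)
From HB Require Import structures.
From mathcomp Require Import all_boot all_order all_algebra.
From mathcomp Require Import all_classical all_reals all_analysis.

Set Implicit Arguments.
Unset Strict Implicit.
Unset Printing Implicit Defensive.

Import Order.TTheory GRing.Theory Num.Theory numFieldNormedType.Exports.

Local Open Scope classical_set_scope.
Local Open Scope ring_scope.

(* C^n regularity on an open subset V of R^6; the case n.+1 asks for
   differentiability and for all directional derivatives to be C^n. *)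
Fixpoint of_Cn (R : realType) (W : normedModType R) (n : nat)
    (V : set 'rV[R]_6) (f : 'rV[R]_6 -> W) : Prop :=
  match n with
  | 0 => forall x, V x -> {for x, continuous f}
  | m.+1 => (forall x, V x -> differentiable f x) /\
            (forall v : 'rV[R]_6, of_Cn m V (fun x => 'D_v f x))
  end.

Definition smooth_on (R : realType) (W : normedModType R)
    (V : set 'rV[R]_6) (f : 'rV[R]_6 -> W) : Prop :=
  forall n, of_Cn n V f.

(* The real 8-dimensional representation of Cl_6, in a basis orthonormal for an
   inner product making vectors skew: [gen a] is the action of the a-th vector
   of the standard basis of R^6. *)
Record clifford_module (R : realType) := CliffordModule {
  gen :> 'I_6 -> 'M[R]_8;
  gen_clifford : forall a b,
    gen a *m gen b + gen b *m gen a = (- 2 * (a == b)%:R)%:M;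
  gen_skew : forall a, (gen a)^T = - gen a }.

Section CliffordAlgebra.
Variables (R : realType) (C : clifford_module R).

Definition cliff (X : 'rV[R]_6) : 'M[R]_8 := \sum_(a < 6) X ord0 a *: C a.

Definition volj : 'M[R]_8 := \prod_(a < 6) C a.

Definition ip (m : nat) (u v : 'cV[R]_m) : R := (u^T *m v) ord0 ord0.

(* Spin(6) as the group of even products of unit vectors; Cl_6 acts faithfully
   on R^8, so this group may be taken inside 'M_8. *)
Definition spin_group (s : 'M[R]_8) : Prop :=
  exists vs : seq 'rV[R]_6,
    [/\ ~~ odd (size vs),
        forall v, v \in vs -> ip v^T v^T = 1
      & s = \prod_(v <- vs) cliff v].

End CliffordAlgebra.

Record oriented_atlas (R : realType) (M : topologicalType) := OrientedAtlas {
  idx : Type;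
  dom : idx -> set M;
  img : idx -> set 'rV[R]_6;
  chart : idx -> M -> 'rV[R]_6;
  param : idx -> 'rV[R]_6 -> M;
  atlas_hausdorff : hausdorff_space M;
  atlas_second_countable : @second_countable M;
  dom_open : forall i, open (dom i);
  img_open : forall i, open (img i);
  dom_cover : forall p, exists i, dom i p;
  chart_img : forall i p, dom i p -> img i (chart i p);
  param_dom : forall i x, img i x -> dom i (param i x);
  chartK : forall i p, dom i p -> param i (chart i p) = p;
  paramK : forall i x, img i x -> chart i (param i x) = x;
  chart_continuous : forall i p, dom i p -> {for p, continuous (chart i)};
  param_continuous : forall i x, img i x -> {for x, continuous (param i)};
  trans_smooth : forall i j,
    smooth_on [set x | img i x /\ dom j (param i x)] (chart j \o param i);
  trans_oriented : forall i j x, img i x -> dom j (param i x) ->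
    0 < \det ('J (chart j \o param i) x) }.

Section Manifold.
Variables (R : realType) (M : topologicalType) (A : oriented_atlas R M).

Definition overlap (i j : idx A) : set 'rV[R]_6 :=
  [set x | img i x /\ dom j (param i x)].

Definition trans (i j : idx A) : 'rV[R]_6 -> 'rV[R]_6 := chart j \o param i.

(* Points of M are represented by their coordinates in all charts. *)
Definition everywhere (Q : idx A -> 'rV[R]_6 -> Prop) : Prop :=
  forall i x, img i x -> Q i x.

(* [metric i x] is the Gram matrix of the coordinate basis. Coordinates of
   tangent vectors are row vectors: v *m 'J f x = 'd f x v. *)
Record riemannian_metric := RiemannianMetric {
  metric :> idx A -> 'rV[R]_6 -> 'M[R]_6;
  metric_smooth : forall i, smooth_on (img i) (metric i);
  metric_sym : forall i x, img i x -> (metric i x)^T = metric i x;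
  metric_pos : forall i x (v : 'rV[R]_6), img i x -> v != 0 ->
    0 < (v *m metric i x *m v^T) ord0 ord0;
  metric_trans : forall i j x, overlap i j x ->
    metric i x =
      'J (trans i j) x *m metric j (trans i j x) *m ('J (trans i j) x)^T }.

Variable g : riemannian_metric.

Definition christoffel (i : idx A) (x : 'rV[R]_6) (k a b : 'I_6) : R :=
  let d (c : 'I_6) (p q : 'I_6) : R :=
    'D_(delta_mx ord0 c : 'rV[R]_6) (fun y => g i y p q) x in
  2^-1 * \sum_(l < 6) invmx (g i x) k l * (d a b l + d b a l - d l a b).

(* The Levi-Civita derivative, at x, of the vector field Y in the direction v,
   in the coordinates of the chart i. *)
Definition levi_civita (i : idx A) (x v : 'rV[R]_6)
    (Y : 'rV[R]_6 -> 'rV[R]_6) : 'rV[R]_6 :=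
  'D_v Y x + \row_k \sum_(a < 6) \sum_(b < 6)
               christoffel i x k a b * v ord0 a * Y x ord0 b.

Variable C : clifford_module R.

(* A Spin(6)-structure given by its cocycle. The rows of [frame i x] are the
   coordinates of a positive orthonormal frame e_1, .., e_6, and [lift i j]
   lifts to Spin(6) the change from the frame i to the frame j: the vector with
   components X in the frame i has components
   X *m frame i x *m 'J (trans i j) x *m invmx (frame j (trans i j x))
   in the frame j. *)
Record spin_structure := SpinStructure {
  frame : idx A -> 'rV[R]_6 -> 'M[R]_6;
  lift : idx A -> idx A -> 'rV[R]_6 -> 'M[R]_8;
  frame_smooth : forall i, smooth_on (img i) (frame i);
  frame_orthonormal : forall i x, img i x ->
    frame i x *m g i x *m (frame i x)^T = 1%:M;
  frame_oriented : forall i x, img i x -> 0 < \det (frame i x);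
  lift_smooth : forall i j, smooth_on (overlap i j) (lift i j);
  lift_spin : forall i j x, overlap i j x -> spin_group C (lift i j x);
  lift_frame : forall i j x (X : 'rV[R]_6), overlap i j x ->
    cliff C X *m lift i j x =
      lift i j x *m cliff C (X *m frame i x *m 'J (trans i j) x
                               *m invmx (frame j (trans i j x)));
  lift_cocycle : forall i j k x, overlap i j x -> overlap i k x ->
    lift i j x *m lift j k (trans i j x) = lift i k x }.

Variable P : spin_structure.

(* Sections of the spinor bundle associated with P. *)
Record spinor_field := SpinorField {
  spinor :> idx A -> 'rV[R]_6 -> 'cV[R]_8;
  spinor_smooth : forall i, smooth_on (img i) (spinor i);
  spinor_trans : forall i j x, overlap i j x ->
    spinor i x = lift P i j x *m spinor j (trans i j x) }.

Variable phi : spinor_field.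

(* From here on, tangent vectors are given by their components X in the
   orthonormal frame, so that Clifford multiplication is [cliff C X]. *)

(* g(\nabla_X e_a, e_b) *)
Definition connection_form (i : idx A) (x X : 'rV[R]_6) (a b : 'I_6) : R :=
  (levi_civita i x (X *m frame P i x) (fun y => row a (frame P i y))
     *m g i x *m (row b (frame P i x))^T) ord0 ord0.

(* \nabla_X phi = X(phi) + 1/4 \sum_(a, b) g(\nabla_X e_a, e_b) e_a e_b phi *)
Definition nabla (i : idx A) (x X : 'rV[R]_6) : 'cV[R]_8 :=
  'D_(X *m frame P i x) (phi i) x +
  4^-1 *: \sum_(a < 6) \sum_(b < 6)
            connection_form i x X a b *: (C a *m C b *m phi i x).

Definition spin_dirac (i : idx A) (x : 'rV[R]_6) : 'cV[R]_8 :=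
  \sum_(a < 6) C a *m nabla i x (delta_mx ord0 a).

Definition jphi (i : idx A) (x : 'rV[R]_6) : 'cV[R]_8 := volj C *m phi i x.

Definition eta_of (i : idx A) (x X : 'rV[R]_6) : R := ip (nabla i x X) (jphi i x).

Definition lambda_of (i : idx A) (x : 'rV[R]_6) : R :=
  6^-1 * ip (spin_dirac i x) (jphi i x).

Definition mu_of (i : idx A) (x : 'rV[R]_6) : R :=
  - (6^-1 * ip (spin_dirac i x) (phi i x)).

(* An endomorphism field T of TM, in frame components: T(X) is X *m T i x. *)
Definition endo_field : Type := idx A -> 'rV[R]_6 -> 'M[R]_6.

Definition unit_spinor : Prop := everywhere (fun i x => ip (phi i x) (phi i x) = 1).

(* For a unit spinor, phi, j(phi), e_1 phi, .., e_6 phi is an orthonormal basis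
   of R^8; hence the two equations below have exactly one solution each, with
   entries (j(e_a phi), e_b phi) and (nabla_{e_a} phi, e_b phi). *)
Definition is_Jphi (J : endo_field) : Prop :=
  everywhere (fun i x => forall X : 'rV[R]_6,
    cliff C (X *m J i x) *m phi i x = volj C *m (cliff C X *m phi i x)).

Definition is_Sphi (S : endo_field) : Prop :=
  everywhere (fun i x => forall X : 'rV[R]_6,
    nabla i x X = eta_of i x X *: jphi i x + cliff C (X *m S i x) *m phi i x).

End Manifold.

Inductive torsion_class := chi1 | chi1b | chi2 | chi2b | chi3 | chi4 | chi5.

(* One-forms are columns: eta(X) = X *m eta. With row vectors, S *m J is the
   matrix of J o S; the conditions below do not depend on this order. *)
Definition in_chi (R : realType) (J : 'M[R]_6) (k : torsion_class)
    (S : 'M[R]_6) (e : 'cV[R]_6) : Prop :=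
  match k with
  | chi1 => (exists r : R, S = r *: J) /\ e = 0
  | chi1b => (exists r : R, S = r%:M) /\ e = 0
  | chi2 => [/\ S^T = - S, S *m J = J *m S, \tr (J *m S) = 0 & e = 0]
  | chi2b => [/\ S^T = S, \tr S = 0, S *m J = J *m S & e = 0]
  | chi3 => [/\ S^T = S, \tr S = 0, S *m J = - (J *m S) & e = 0]
  | chi4 => [/\ S^T = - S, S *m J = - (J *m S) & e = 0]
  | chi5 => S = 0
  end.

(* The components T k, t k with k not in ks are irrelevant (0 lies in each
   class). *)
Definition in_chi_sum (R : realType) (J : 'M[R]_6) (ks : seq torsion_class)
    (S : 'M[R]_6) (e : 'cV[R]_6) : Prop :=
  exists (T : torsion_class -> 'M[R]_6) (t : torsion_class -> 'cV[R]_6),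
    [/\ forall k, in_chi J k (T k) (t k),
        S = \sum_(k <- ks) T k
      & e = \sum_(k <- ks) t k].

Definition of_class (R : realType) (M : topologicalType)
    (A : oriented_atlas R M) (g : riemannian_metric A) (C : clifford_module R)
    (P : spin_structure g C) (phi : spinor_field P) (J S : endo_field A)
    (ks : seq torsion_class) : Prop :=
  everywhere (fun i x =>
    in_chi_sum (J i x) ks (S i x) (\col_a eta_of phi i x (delta_mx ord0 a))).

(* Main.v *)
Require Import Defs.
From HB Require Import structures.
From mathcomp Require Import all_boot all_order all_algebra.
From mathcomp Require Import all_classical all_reals all_analysis.
From mathcomp Require Import ring lra zify.
Import Order.TTheory GRing.Theory Num.Theory numFieldNormedType.Exports.
Local Open Scope classical_set_scope.
Local Open Scope ring_scope.

(* At each point, phi, j(phi) and the e_a phi form an orthogonal basis of the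
   spinors, so that every spinorial condition can be read off on (S, eta): the
   conditions on (Y nabla_X phi, phi) and (Y nabla_X phi, j(phi)) say whether S
   commutes or anticommutes with J and whether S J is symmetric or skew, lambda
   and mu are multiples of tr(S J) and tr(S), and the remaining part of D phi is
   governed by sum S_ab e_a e_b phi, whose component in TM phi vanishes exactly
   when the skew part of S commutes with J.

   It remains to prove that lambda and mu are constant in the classes chi1 and
   chi1b. Replacing phi by phi + j(phi) turns the equation of chi1 into the one
   of chi1b, nabla_X psi = mu X psi. Consider the forms
   w(X, Y) = (X Y psi, j psi) and W(X, Y, Z) = (X Y Z psi, j psi); the equation
   gives dw = 6 mu W and dW = 0, hence dmu /\ W = 0 and then dmu = 0. As w and W
   do not depend on the chart, neither does mu, which is thus locally constant
   on M. *)

(** * Clifford modules *)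

(** [nabla], lambda and mu are computed chart by chart, in a local orthonormal frame, so that the
    agreement of mu on overlaps has to be proved. It rests on algebra: a lift to Spin(6) intertwines
    the Clifford multiplications of the two frames, commutes with j and is an isometry, whence w and
    W agree; the naturality of d, applied to dw = 6 mu W in both charts, passes this on to mu. The
    factor 6 arises because psi occurs twice in w, each occurrence contributing mu W, and the
    exterior derivative has three terms. The spinor phi + j(phi) has the same J as phi, but square
    norm 2; this is why the frame phi, j(phi), e_a phi is studied for an arbitrary square norm c >
    0. On the algebraic side, membership in a sum of classes is turned into the vanishing of the
    projections of S onto the missing classes (and of eta if chi5 is missing). Each item of the
    theorem then follows by propositional logic from a handful of equivalences, one for each type of
    spinorial condition. *)

Section InnerProduct.
Context {R : realType} {m : nat}.
Implicit Types u v w : 'cV[R]_m.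

Lemma ipE u v : ip u v = \sum_k u k 0 * v k 0.
Proof. by rewrite /ip mxE; apply: eq_bigr => k _; rewrite mxE. Qed.

Lemma ipC u v : ip u v = ip v u.
Proof. by rewrite !ipE; apply: eq_bigr => k _; rewrite mulrC. Qed.

Lemma ipDl u v w : ip (u + v) w = ip u w + ip v w.
Proof. by rewrite /ip linearD mulmxDl mxE. Qed.

Lemma ipDr u v w : ip w (u + v) = ip w u + ip w v.
Proof. by rewrite /ip mulmxDr mxE. Qed.

Lemma ipZl a u v : ip (a *: u) v = a * ip u v.
Proof. by rewrite /ip linearZ -scalemxAl mxE. Qed.

Lemma ipZr a u v : ip u (a *: v) = a * ip u v.
Proof. by rewrite /ip -scalemxAr mxE. Qed.

Lemma ipNl u v : ip (- u) v = - ip u v.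
Proof. by rewrite -scaleN1r ipZl mulN1r. Qed.

Lemma ipNr u v : ip u (- v) = - ip u v.
Proof. by rewrite -scaleN1r ipZr mulN1r. Qed.

Lemma ip0l u : ip 0 u = 0.
Proof. by rewrite -(scale0r 0) ipZl mul0r. Qed.

Lemma ip_suml (I : finType) (F : I -> 'cV[R]_m) u :
  ip (\sum_i F i) u = \sum_i ip (F i) u.
Proof.
by apply: (big_morph (fun v => ip v u)) => [v w|]; rewrite ?ipDl ?ip0l.
Qed.

Lemma ip_mull (A : 'M[R]_m) u v : ip (A *m u) v = ip u (A^T *m v).
Proof. by rewrite /ip trmx_mul mulmxA. Qed.

Lemma ip_gt0 u : u != 0 -> 0 < ip u u.
Proof.
move=> u0; have [k uk0] : exists k, u k 0 != 0.
  apply/existsP; apply: contraNT u0; rewrite negb_exists => /forallP h.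
  apply/eqP/matrixP => a b; rewrite ord1 mxE; exact/eqP/negPn/h.
rewrite ipE (bigD1 k)//= ltr_pwDl// ?sumr_ge0// => [|a _].
  by rewrite -expr2 exprn_even_gt0.
by rewrite -expr2 sqr_ge0.
Qed.

End InnerProduct.

Section CliffordAlgebra.
Context {R : realType} (C : clifford_module R).
Implicit Types X Y Z : 'rV[R]_6.
Local Notation j := (volj C).
Local Notation cl := (cliff C).

Definition dot X Y : R := (X *m Y^T) 0 0.

Lemma dotE X Y : dot X Y = \sum_a X 0 a * Y 0 a.
Proof. by rewrite /dot mxE; apply: eq_bigr => a _; rewrite mxE. Qed.

Lemma dotC X Y : dot X Y = dot Y X.
Proof. by rewrite !dotE; apply: eq_bigr => a _; rewrite mulrC. Qed.

Lemma dot_delta a X : dot (delta_mx 0 a) X = X 0 a.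
Proof. by rewrite /dot -rowE !mxE. Qed.

Lemma dot_gt0 X : X != 0 -> 0 < dot X X.
Proof.
by rewrite -(inj_eq trmx_inj) trmx0 => /ip_gt0; rewrite /ip trmxK.
Qed.

Lemma cliff_is_linear : linear (cliff C).
Proof.
move=> a X Y; rewrite /cliff scaler_sumr -big_split; apply: eq_bigr => b _ /=.
by rewrite !mxE scalerDl scalerA.
Qed.

HB.instance Definition _ :=
  GRing.isLinear.Build R 'rV[R]_6 'M[R]_8 _ (cliff C) cliff_is_linear.

Lemma cliff_delta a : cl (delta_mx 0 a) = C a.
Proof.
rewrite /cliff (bigD1 a)//= mxE !eqxx scale1r big1 ?addr0// => b ba.
by rewrite mxE eqxx (negbTE ba) scale0r.
Qed.

Lemma cliffE X : cl X = \sum_a X 0 a *: C a. Proof. by []. Qed.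

Lemma cliff_sum (I : finType) (F : I -> 'rV[R]_6) :
  cl (\sum_i F i) = \sum_i cl (F i).
Proof. exact: linear_sum. Qed.

Lemma cliffZ a X : cl (a *: X) = a *: cl X.
Proof. exact: linearZ. Qed.

Lemma cliff0 : cl 0 = 0.
Proof. exact: linear0. Qed.

Lemma cliffN X : cl (- X) = - cl X.
Proof. exact: linearN. Qed.

Lemma cliffD X Y : cl (X + Y) = cl X + cl Y.
Proof. exact: linearD. Qed.

Lemma cliff_anticomm X Y : cl X *m cl Y + cl Y *m cl X = (- 2 * dot X Y)%:M.
Proof.
rewrite !cliffE dotE !mulmx_suml.
under eq_bigr do rewrite mulmx_sumr.
under [X in _ + X]eq_bigr do rewrite mulmx_sumr.
rewrite [X in _ + X]exchange_big -big_split/= mulr_sumr raddf_sum/=.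
apply: eq_bigr => a _; rewrite -big_split/= (bigD1 a)//= [X in _ + X]big1.
  rewrite addr0 -!scalemxAl -!scalemxAr !scalerA [Y _ _ * _]mulrC -scalerDr.
  by rewrite gen_clifford eqxx mulr1 scale_scalar_mx mulrC.
move=> b ba; rewrite -!scalemxAl -!scalemxAr !scalerA [Y _ _ * _]mulrC.
by rewrite -scalerDr gen_clifford eq_sym (negbTE ba) mulr0 scale_scalar_mx mulr0 raddf0.
Qed.

Lemma cliff_swap X Y : cl X *m cl Y = - (cl Y *m cl X) - (2 * dot X Y)%:M.
Proof.
apply/eqP; rewrite -subr_eq0 !opprD !opprK addrA cliff_anticomm.
by rewrite -raddfD/= mulNr addNr raddf0.
Qed.

Lemma cliff_sq X : cl X *m cl X = (- dot X X)%:M.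
Proof.
have h := cliff_anticomm X X.
apply: (@scalerI _ _ 2); first by rewrite pnatr_eq0.
by rewrite scale_scalar_mx mulrN -mulNr -h scaler_nat mulr2n.
Qed.

Lemma cliff_tr X : (cl X)^T = - cl X.
Proof.
rewrite !cliffE linear_sum/= -sumrN; apply: eq_bigr => a _.
by rewrite linearZ/= gen_skew scalerN.
Qed.

Lemma gen_comm a b : C b *m C a = (-1) ^+ (b != a) *: (C a *m C b).
Proof.
have [->|ba] := eqVneq b a; first by rewrite scale1r.
have := gen_clifford C b a; rewrite (negbTE ba) mulr0 raddf0 => /eqP.
by rewrite addr_eq0 => /eqP ->; rewrite expr1 scaleN1r.
Qed.

(** Moving [C a] to the front changes the sign once for each factor different from it. *)
Lemma prod_gen_comm a (s : seq 'I_6) :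
  \prod_(b <- s) C b *m C a
    = (-1) ^+ count (predC1 a) s *: (C a *m \prod_(b <- s) C b).
Proof.
elim: s => [|b s ih]; first by rewrite !big_nil scale1r mul1mx mulmx1.
rewrite !big_cons/= -mulmxA ih -scalemxAr mulmxA gen_comm -scalemxAl scalerA.
by rewrite exprD mulrC mulmxA.
Qed.

Lemma size_index_enum_ord n : size (index_enum 'I_n) = n.
Proof. by rewrite [index_enum _]unlock -enumT size_enum_ord. Qed.

Lemma volj_cliff X : j *m cl X = - (cl X *m j).
Proof.
rewrite !cliffE mulmx_sumr mulmx_suml -sumrN; apply: eq_bigr => a _.
rewrite -scalemxAl -scalemxAr -scalerN; congr (_ *: _).
rewrite prod_gen_comm.
(* Of the six factors of j exactly one is [C a], so five signs remain, an odd number. *)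
rewrite (_ : count _ _ = 5%N); first by rewrite -signr_odd expr1 scaleN1r.
have := count_predC (pred1 a) (index_enum 'I_6).
rewrite -[X in X + _ = _]/(count_mem a _) count_uniq_mem ?index_enum_uniq//.
rewrite mem_index_enum /= => h; apply/eqP.
rewrite -(eqn_add2l 1%N); apply/eqP; apply: etrans h _.
by rewrite size_index_enum_ord.
Qed.

(** Each skew factor gives one sign, and restoring the order of n factors takes 'C(n, 2)
    transpositions. For n = 6 the exponent is 6 + 15, which makes j skew. *)
Lemma prod_gen_tr (s : seq 'I_6) : uniq s ->
  (\prod_(b <- s) C b)^T
    = (-1) ^+ (size s + 'C(size s, 2)) *: \prod_(b <- s) C b.
Proof.
elim: s => [|b s ih] /=; first by rewrite !big_nil trmx1 scale1r.
case/andP=> bs us; rewrite !big_cons trmx_mul ih// gen_skew.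
rewrite mulmxN -scalemxAl prod_gen_comm scalerA -scaleN1r scalerA.
rewrite (_ : count _ _ = size s); last first.
  by apply/eqP; rewrite -all_count; apply/allP => a /=; apply: contraTneq => -> //.
congr (_ *: _); rewrite -exprD -exprS; congr (_ ^+ _).
by rewrite binS bin1; lia.
Qed.

Lemma volj_tr : j^T = - j.
Proof.
rewrite prod_gen_tr ?index_enum_uniq// size_index_enum_ord.
by rewrite -signr_odd (_ : odd _ = true) ?scaleN1r.
Qed.

Lemma prod_gen_orth (s : seq 'I_6) :
  (\prod_(b <- s) C b)^T *m \prod_(b <- s) C b = 1%:M.
Proof.
elim: s => [|b s ih]; first by rewrite !big_nil trmx1 mul1mx.
rewrite !big_cons trmx_mul mulmxA -(mulmxA _ (C b)^T) gen_skew mulNmx.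
rewrite -cliff_delta cliff_sq -raddfN/= opprK dot_delta mxE !eqxx mulmx1.
exact: ih.
Qed.

(** j is orthogonal and skew. *)
Lemma volj_sq : j *m j = - 1%:M.
Proof. by rewrite -(prod_gen_orth (index_enum _)) volj_tr mulNmx opprK. Qed.

Lemma ip_cliff X (u v : 'cV[R]_8) : ip (cl X *m u) v = - ip u (cl X *m v).
Proof. by rewrite ip_mull cliff_tr mulNmx ipNr. Qed.

Lemma ip_volj (u v : 'cV[R]_8) : ip (j *m u) v = - ip u (j *m v).
Proof. by rewrite ip_mull volj_tr mulNmx ipNr. Qed.

End CliffordAlgebra.

(** * Quadratic elements of the Clifford algebra *)

Section CliffordQuadratic.
Context {R : realType} (C : clifford_module R).
Implicit Types X Y Z : 'rV[R]_6.
Local Notation j := (volj C).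
Local Notation cl := (cliff C).

(** The quantization of a 2-tensor. On skew matrices, a quarter of it is the Lie algebra isomorphism
    of so(6) with spin(6), up to sign conventions. *)
Definition cliff2 (A : 'M[R]_6) : 'M[R]_8 := \sum_a C a *m cl (row a A).

Lemma cliff2E A : cliff2 A = \sum_a \sum_b A a b *: (C a *m C b).
Proof.
apply: eq_bigr => a _; rewrite cliffE mulmx_sumr; apply: eq_bigr => b _.
by rewrite !mxE scalemxAr.
Qed.

Lemma cliff2_is_linear : linear cliff2.
Proof.
move=> k A B; rewrite /cliff2 scaler_sumr -big_split; apply: eq_bigr => b _ /=.
by rewrite !linearP.
Qed.

HB.instance Definition _ :=
  GRing.isLinear.Build R 'M[R]_6 'M[R]_8 _ cliff2 cliff2_is_linear.

Lemma cliff2_frame (M N : 'M[R]_6) :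
  \sum_a cl (row a M) *m cl (row a N) = cliff2 (M^T *m N).
Proof.
rewrite /cliff2; under eq_bigr do rewrite [X in X *m _]cliffE mulmx_suml.
rewrite exchange_big; apply: eq_bigr => b _ /=.
rewrite row_mul mulmx_sum_row cliff_sum mulmx_sumr; apply: eq_bigr => a _.
by rewrite cliffZ -scalemxAl -scalemxAr !mxE.
Qed.

Lemma cliff2_addtr A : cliff2 A + cliff2 A^T = (- 2 * \tr A)%:M.
Proof.
rewrite !cliff2E [X in _ + X]exchange_big -big_split/=.
transitivity (\sum_a (- 2 * A a a)%:M : 'M[R]_8); last first.
  by rewrite -raddf_sum/= -mulr_sumr.
apply: eq_bigr => a _; rewrite -big_split/= (bigD1 a)//= [X in _ + X]big1.
  by rewrite addr0 !mxE -scalerDr gen_clifford eqxx mulr1 scale_scalar_mx mulrC.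
move=> b ba; rewrite !mxE -scalerDr gen_clifford eq_sym (negbTE ba).
by rewrite mulr0 scale_scalar_mx mulr0 raddf0.
Qed.

Lemma cliff2_tr A : (cliff2 A)^T = cliff2 A^T.
Proof.
rewrite !cliff2E linear_sum exchange_big; apply: eq_bigr => a _ /=.
rewrite linear_sum; apply: eq_bigr => b _ /=.
by rewrite linearZ/= trmx_mul !gen_skew mulmxN mulNmx opprK mxE.
Qed.

Lemma cliff2_volj A : cliff2 A *m j = j *m cliff2 A.
Proof.
rewrite /cliff2 mulmx_suml mulmx_sumr; apply: eq_bigr => a _.
rewrite -cliff_delta mulmxA volj_cliff mulNmx -!mulmxA volj_cliff.
by rewrite mulmxN opprK.
Qed.

(** The infinitesimal form of the covering of SO(6) by Spin(6). Moving X across the two factors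
    leaves two contractions, which coincide because A is skew: 4 = 2 + 2. This identity makes
    Clifford multiplication parallel. *)
Lemma cliff2_comm A X : A^T = - A ->
  cliff2 A *m cl X - cl X *m cliff2 A = 4 *: cl (X *m A).
Proof.
move=> Askew; rewrite /cliff2 mulmx_suml mulmx_sumr -sumrB.
have step a : C a *m cl (row a A) *m cl X - cl X *m (C a *m cl (row a A))
    = 2 *: (X 0 a *: cl (row a A)) - 2 *: (dot (row a A) X *: C a).
  have h1 : C a *m cl X = - (cl X *m C a) - (2 * X 0 a)%:M.
    by rewrite -cliff_delta cliff_swap dot_delta.
  rewrite -mulmxA cliff_swap mulmxBr mulmxN !mulmxA h1 mulmxBl mulNmx.
  rewrite mul_scalar_mx mul_mx_scalar opprB opprK !scalerA.
  by rewrite [_ - _ *: _ in LHS]addrAC addrK.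
under eq_bigr do rewrite step.
rewrite sumrB -!scaler_sumr.
have -> : \sum_a X 0 a *: cl (row a A) = cl (X *m A).
  by rewrite mulmx_sum_row cliff_sum; apply: eq_bigr => a _; rewrite cliffZ.
have -> : \sum_a dot (row a A) X *: C a = - cl (X *m A).
  rewrite -cliffN -mulmxN -Askew cliffE; apply: eq_bigr => a _.
  rewrite dotC dotE mxE; congr (_ *: _).
  by apply: eq_bigr => b _; rewrite !mxE.
by rewrite scalerN opprK -scalerDl -natrD.
Qed.

End CliffordQuadratic.

Section RowVectors.
Context {R : realType}.
Implicit Types A B : 'M[R]_6.

Lemma mulmx_rV_inj A B : (forall X : 'rV[R]_6, X *m A = X *m B) -> A = B.
Proof. by move=> AB; apply/row_matrixP => i; rewrite !rowE. Qed.

Lemma dot_mulmx (X Y : 'rV[R]_6) A : dot X (Y *m A^T) = dot (X *m A) Y.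
Proof. by rewrite /dot trmx_mul trmxK mulmxA. Qed.

Lemma dotNl (X Y : 'rV[R]_6) : dot (- X) Y = - dot X Y.
Proof. by rewrite /dot mulNmx mxE. Qed.

Lemma dotNr (X Y : 'rV[R]_6) : dot X (- Y) = - dot X Y.
Proof. by rewrite dotC dotNl dotC. Qed.

Lemma dot_mx_inj A B :
  (forall X Y : 'rV[R]_6, dot (X *m A) Y = dot (X *m B) Y) -> A = B.
Proof.
move=> AB; apply/matrixP => a b.
have := AB (delta_mx 0 a) (delta_mx 0 b).
by rewrite -!rowE ![dot (row _ _) _]dotC !dot_delta !mxE.
Qed.

End RowVectors.

(** * The frame phi, j(phi), e_a phi and the almost complex structure J *)

Section SpinorFrame.
Context {R : realType} (C : clifford_module R).
Variables (phi : 'cV[R]_8) (c : R).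
Hypotheses (phi_norm : ip phi phi = c) (c_gt0 : 0 < c).
Implicit Types X Y Z : 'rV[R]_6.
Local Notation j := (volj C).
Local Notation cl := (cliff C).
Local Notation jphi := (j *m phi).

Lemma ip_phi_jphi : ip phi jphi = 0.
Proof. by have := ip_volj C phi phi; rewrite ipC; lra. Qed.

Lemma ip_jphi_jphi : ip jphi jphi = c.
Proof. by rewrite ip_volj mulmxA volj_sq mulNmx mul1mx ipNr opprK. Qed.

Lemma ip_cliff_phi X : ip (cl X *m phi) phi = 0.
Proof. by have := ip_cliff C X phi phi; rewrite [in RHS]ipC; lra. Qed.

(** The composite of j with a vector is again skew, since the two are skew and anticommute. *)
Lemma ip_cliff_jphi X : ip (cl X *m phi) jphi = 0.
Proof.
have := ip_cliff C X phi jphi.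
rewrite mulmxA -[cl X *m j]opprK -volj_cliff mulNmx ipNr opprK.
by rewrite -mulmxA ipC ip_volj; lra.
Qed.

Lemma ip_cliff_cliff X Y : ip (cl X *m phi) (cl Y *m phi) = c * dot X Y.
Proof.
have h1 := ip_cliff C X phi (cl Y *m phi).
have h2 := ip_cliff C Y phi (cl X *m phi).
rewrite (ipC (cl Y *m phi)) in h2.
have : ip phi ((cl X *m cl Y + cl Y *m cl X) *m phi) = - 2 * (c * dot X Y).
  by rewrite cliff_anticomm mul_scalar_mx ipZr phi_norm; ring.
by rewrite mulmxDl ipDr -!mulmxA; lra.
Qed.

Lemma cliff_phi_inj X Y : cl X *m phi = cl Y *m phi -> X = Y.
Proof.
move=> /eqP; rewrite -subr_eq0 -mulmxBl -linearB/= => /eqP h.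
apply/eqP; rewrite -subr_eq0; apply/negP => /negP /dot_gt0.
rewrite -(pmulr_rgt0 _ c_gt0) -ip_cliff_cliff.
by rewrite [cl (X - Y) *m phi]h ip0l ltxx.
Qed.

(* 8 = 1 + 1 + 6: the spinors below are the columns of a square matrix with
   orthogonal columns of equal length. *)
Lemma spinor_ext (u : 'cV[R]_8) : ip u phi = 0 -> ip u jphi = 0 ->
  (forall X, ip u (cl X *m phi) = 0) -> u = 0.
Proof.
move=> u1 u2 u3; pose B : 'M[R]_(8, 6) := \matrix_(k, a) (C a *m phi) k 0.
have BX X : cl X *m phi = B *m X^T.
  rewrite cliffE mulmx_suml; apply/matrixP => k l; rewrite ord1 summxE mxE.
  by apply: eq_bigr => a _; rewrite -scalemxAl !mxE mulrC.
pose U : 'M[R]_(8, 1 + (1 + 6)) := row_mx phi (row_mx jphi B).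
have mx11 (v w : 'cV[R]_8) : v^T *m w = (ip v w)%:M.
  by apply/matrixP => a b; rewrite !ord1 /ip [in RHS]mxE eqxx mulr1n.
have mxB (v : 'cV[R]_8) : (forall X, ip v (cl X *m phi) = 0) -> v^T *m B = 0.
  move=> h; apply/matrixP => a b; rewrite ord1 [RHS]mxE.
  have := h (delta_mx 0 b); rewrite BX /ip trmx_delta mulmxA -colE => <-.
  by rewrite [RHS]mxE.
have UU : U^T *m U = c%:M.
  rewrite /U !tr_row_mx mul_col_row mul_mx_row mul_col_mx mul_col_row.
  rewrite !mx11 phi_norm ip_jphi_jphi ip_phi_jphi (ipC jphi) ip_phi_jphi raddf0.
  have p1 : phi^T *m B = 0 by apply: mxB => X; rewrite ipC ip_cliff_phi.
  have p2 : jphi^T *m B = 0 by apply: mxB => X; rewrite ipC ip_cliff_jphi.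
  have BB : B^T *m B = c%:M.
    apply/matrixP => a b; rewrite [RHS]mxE.
    have := ip_cliff_cliff (delta_mx 0 a) (delta_mx 0 b).
    rewrite !cliff_delta dot_delta ipE [delta_mx _ _ _ _]mxE eqxx /= mulr_natr.
    by rewrite eq_sym => <-; rewrite mxE; apply: eq_bigr => k _; rewrite !mxE.
  rewrite p1 p2 BB -(trmxK (B^T *m phi)) trmx_mul trmxK p1 trmx0.
  rewrite -(trmxK (B^T *m jphi)) trmx_mul trmxK p2 trmx0.
  by rewrite !scalar_mx_block row_mx0 col_mx0.
have Uu : U^T *m u = 0.
  rewrite /U !tr_row_mx !mul_col_mx !mx11 (ipC _ u) u1 (ipC _ u) u2 raddf0.
  by rewrite -(trmxK (B^T *m u)) trmx_mul trmxK mxB// trmx0 !col_mx0.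
have UU' : (c^-1 *: U^T) *m U = 1%:M.
  by rewrite -scalemxAl UU scale_scalar_mx mulVf// gt_eqF.
have := mulmx1C UU'; rewrite -scalemxAr scalemxAl => UU2.
by rewrite -[u]mul1mx -UU2 -mulmxA Uu mulmx0.
Qed.

Variable J : 'M[R]_6.
Hypothesis J_phi : forall X, cl (X *m J) *m phi = j *m (cl X *m phi).

Lemma Jphi_sq : J *m J = - 1%:M.
Proof.
apply: mulmx_rV_inj => X; apply: cliff_phi_inj.
rewrite mulmxA !J_phi mulmxA volj_sq mulmxN mulmx1 cliffN.
by rewrite !mulNmx mul1mx.
Qed.

(** J is an isometry because j is one; together with J^2 = -1 this makes it skew. *)
Lemma Jphi_tr : J^T = - J.
Proof.
have JJ : J *m J^T = 1%:M.
  apply: dot_mx_inj => X Y; rewrite mulmxA -dot_mulmx trmxK mulmx1.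
  apply: (mulfI (lt0r_neq0 c_gt0)); rewrite -!ip_cliff_cliff !J_phi.
  by rewrite ip_volj mulmxA volj_sq mulNmx mul1mx ipNr opprK.
rewrite -[LHS]mulmx1 -[1%:M]opprK -Jphi_sq mulmxN mulmxA (mulmx1C JJ).
by rewrite mul1mx.
Qed.

Lemma cliff_jphi X : cl X *m jphi = - cl (X *m J) *m phi.
Proof. by rewrite mulmxA -[_ *m j]opprK -volj_cliff !mulNmx J_phi mulmxA. Qed.

(* If Q := cliff2 A kills the component in TM phi, then Q phi = k j(phi), and
   computing Q (JX) phi = j Q X phi through [Q, X] = 4 (X A) gives A J = J A.
   Conversely, (X Y phi, Z phi) changes sign when X and Y are replaced with JX
   and JY, a change of basis under which Q phi is invariant if A J = J A. *)
Lemma cliff2_phi_orthP (A : 'M[R]_6) : A^T = - A ->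
  (forall X, ip (cliff2 C A *m phi) (cl X *m phi) = 0) <-> A *m J = J *m A.
Proof.
move=> Ask; set Q := cliff2 C A; split=> [Q0|AJ X].
  have [k Qphi] : exists k, Q *m phi = k *: jphi.
    exists (c^-1 * ip (Q *m phi) jphi).
    apply/eqP; rewrite -subr_eq0; apply/eqP; apply: spinor_ext => [||X].
    - rewrite ipDl ipNl ipZl (ipC jphi) ip_phi_jphi mulr0 subr0.
      have := ip_mull Q phi phi.
      rewrite cliff2_tr Ask linearN/= mulNmx ipNr -/Q [in RHS]ipC; lra.
    - by rewrite ipDl ipNl ipZl ip_jphi_jphi mulrAC mulVf ?mul1r ?subrr ?gt_eqF.
    - by rewrite ipDl ipNl ipZl Q0 (ipC jphi) ip_cliff_jphi mulr0 subr0.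
  have Qcl X : Q *m (cl X *m phi) = - k *: (cl (X *m J) *m phi)
                                    + 4 *: (cl (X *m A) *m phi).
    have /eqP := cliff2_comm C A X Ask; rewrite subr_eq addrC => /eqP h.
    rewrite mulmxA h mulmxDl -mulmxA -/Q Qphi -scalemxAr cliff_jphi mulNmx.
    by rewrite scalerN scaleNr -scalemxAl.
  apply: mulmx_rV_inj => X; apply: cliff_phi_inj; symmetry.
  apply: (@scalerI _ _ 4); first by rewrite pnatr_eq0.
  apply: (addrI (- k *: (cl (X *m J *m J) *m phi))).
  rewrite mulmxA -Qcl J_phi mulmxA cliff2_volj -mulmxA Qcl mulmxDr.
  by rewrite -!scalemxAr -!J_phi mulmxA.
(* The scalar term of the anticommutation is a multiple of phi, hence orthogonal to Z phi. *)
have swap U V Z : ip (cl U *m (cl V *m phi)) (cl Z *m phi)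
    = - ip (cl V *m (cl U *m phi)) (cl Z *m phi).
  rewrite mulmxA cliff_swap mulmxBl mulNmx ipDl !ipNl mul_scalar_mx ipZl.
  by rewrite (ipC phi) ip_cliff_phi mulr0 subr0 mulmxA.
have move U V Z : ip (cl U *m (cl (V *m J) *m phi)) (cl Z *m phi)
    = ip (cl U *m (cl V *m phi)) (cl (Z *m J) *m phi).
  rewrite !J_phi mulmxA -[cl U *m j]opprK -volj_cliff mulNmx ipNl.
  by rewrite -mulmxA ip_volj opprK.
have JJ U V Z : ip (cl (U *m J) *m (cl (V *m J) *m phi)) (cl Z *m phi)
    = - ip (cl U *m (cl V *m phi)) (cl Z *m phi).
  rewrite move swap move -mulmxA Jphi_sq mulmxN mulmx1 cliffN mulNmx ipNr opprK.
  exact: swap.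
have QE U : ip (Q *m phi) (cl U *m phi)
    = \sum_a ip (cl (delta_mx 0 a) *m (cl (row a A) *m phi)) (cl U *m phi).
  rewrite /Q /cliff2 mulmx_suml ip_suml; apply: eq_bigr => a _.
  by rewrite cliff_delta mulmxA.
suff : ip (Q *m phi) (cl X *m phi) = - ip (Q *m phi) (cl X *m phi) by lra.
rewrite {2}QE -sumrN.
under eq_bigr do rewrite -JJ mulmxA.
rewrite -ip_suml -mulmx_suml.
under eq_bigr do rewrite -rowE -row_mul.
(* In the basis formed by the rows of J, the matrix A becomes J^T A J, which equals A. *)
by rewrite cliff2_frame AJ mulmxA Jphi_tr mulNmx Jphi_sq opprK mul1mx.
Qed.

End SpinorFrame.

(** * The seven classes at a point *)

Section TorsionDecomposition.
Context {R : realType} (J : 'M[R]_6).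
Hypotheses (J_sq : J *m J = - 1%:M) (J_tr : J^T = - J).
Implicit Types S : 'M[R]_6.

Local Notation conjJ S := (J *m S *m J).

(** As J^2 = -1, conjugation by J is an involution: its eigenvalue -1 means commuting with J, its
    eigenvalue 1 anticommuting ([commJP], [anticommJP]). It commutes with transposition, so that the
    two can be diagonalized together. *)
Lemma conjJK S : conjJ (conjJ S) = S.
Proof. by rewrite !mulmxA J_sq -mulmxA J_sq mulmxN mulmx1 !mulNmx mul1mx opprK. Qed.

Lemma conjJ_tr S : (conjJ S)^T = conjJ S^T.
Proof. by rewrite !trmx_mul J_tr mulNmx !mulmxN opprK mulmxA. Qed.

Lemma conjJJ : conjJ J = - J.
Proof. by rewrite J_sq mulNmx mul1mx. Qed.

Lemma conjJ1 : conjJ 1%:M = - 1%:M.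
Proof. by rewrite mulmx1. Qed.

Lemma commJP S : S *m J = J *m S <-> conjJ S = - S.
Proof.
split=> [<-|h]; first by rewrite -mulmxA J_sq mulmxN mulmx1.
have /(congr1 (mulmx J)) := h.
by rewrite !mulmxA J_sq !mulNmx mul1mx mulmxN => /oppr_inj.
Qed.

Lemma anticommJP S : S *m J = - (J *m S) <-> conjJ S = S.
Proof.
split=> [h|h].
  by apply: oppr_inj; rewrite -mulNmx -h -mulmxA J_sq mulmxN mulmx1.
have /(congr1 (mulmx J)) := h.
by rewrite !mulmxA J_sq !mulNmx mul1mx => <-; rewrite opprK.
Qed.

Lemma mxtrace_JJ : \tr (J *m J) = - 6.
Proof. by rewrite J_sq linearN/= mxtrace1. Qed.

Lemma mxtrace_conjJ S : \tr (conjJ S) = - \tr S.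
Proof. by rewrite mxtrace_mulC mulmxA J_sq mulNmx mul1mx linearN. Qed.

Lemma mxtrace_conjJJ S : \tr (conjJ S *m J) = - \tr (S *m J).
Proof. by rewrite -mulmxA J_sq mulmxN mulmx1 linearN/= mxtrace_mulC. Qed.

Lemma mxtrace_trJ S : \tr (S^T *m J) = - \tr (S *m J).
Proof.
by rewrite -[in RHS]mxtrace_tr trmx_mul J_tr mulNmx linearN/= opprK mxtrace_mulC.
Qed.

(** The coefficients of S along J and along the identity, normalized by tr(J^2) = -6 and tr(1) = 6.
    They turn out to be lambda and mu ([dirac_jphi], [dirac_phi]). *)
Definition lamS S := - (6^-1 * \tr (S *m J)).
Definition muS S := 6^-1 * \tr S.

(* The projections of S onto the classes: the averages over conjugation by J and
   transposition, the multiples of J and of the identity being split off. *)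
Definition torsion_part S (k : torsion_class) : 'M[R]_6 :=
  match k with
  | chi1 => lamS S *: J
  | chi1b => (muS S)%:M
  | chi2 => 4^-1 *: (S - S^T - (conjJ S - conjJ S^T)) - lamS S *: J
  | chi2b => 4^-1 *: (S + S^T - (conjJ S + conjJ S^T)) - (muS S)%:M
  | chi3 => 4^-1 *: (S + S^T + (conjJ S + conjJ S^T))
  | chi4 => 4^-1 *: (S - S^T + (conjJ S - conjJ S^T))
  | chi5 => 0
  end.

Lemma in_chi_torsion_part S k : in_chi J k (torsion_part S k) 0.
Proof.
case: k => //=.
- by split=> //; exists (lamS S).
- by split=> //; exists (muS S).
- split=> //.
  + rewrite !(linearB, linearZ, linearD) /= !conjJ_tr trmxK J_tr.
    (* With the matrix products generalized, only an identity that is linear in the entries is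
       left. *)
    by move: (conjJ S) (conjJ S^T) => A B; apply/matrixP => a b; rewrite !mxE; ring.
  + apply/commJP.
    rewrite mulmxBr mulmxBl -!scalemxAr -!scalemxAl conjJJ !mulmxBr !mulmxBl !conjJK.
    by move: (conjJ S) (conjJ S^T) => A B; apply/matrixP => a b; rewrite !mxE; ring.
  + rewrite mxtrace_mulC mulmxBl linearB/= -!scalemxAl !linearZ/= mxtrace_JJ.
    rewrite !mulmxBl !linearB/= !mxtrace_conjJJ !mxtrace_trJ /lamS.
    by rewrite -[_ *: _]/(_ * _); field.
- split=> //.
  + rewrite !(linearB, linearZ, linearD) /= !conjJ_tr trmxK tr_scalar_mx.
    by move: (conjJ S) (conjJ S^T) => A B; apply/matrixP => a b; rewrite !mxE; ring.
  + rewrite linearB/= linearZ/= !(linearB, linearD) /= !mxtrace_conjJ.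
    by rewrite mxtrace_tr mxtrace_scalar /muS; field.
  + apply/commJP; rewrite -[(muS S)%:M]scalemx1.
    rewrite mulmxBr mulmxBl -!scalemxAr -!scalemxAl conjJ1 mulmxBr mulmxBl.
    rewrite !mulmxDr !mulmxDl !conjJK.
    by move: (conjJ S) (conjJ S^T) => A B; apply/matrixP => a b; rewrite !mxE; ring.
- split=> //.
  + rewrite !(linearB, linearZ, linearD) /= !conjJ_tr trmxK.
    by move: (conjJ S) (conjJ S^T) => A B; apply/matrixP => a b; rewrite !mxE; ring.
  + rewrite linearZ/= !(linearB, linearD) /= !mxtrace_conjJ.
    by rewrite mxtrace_tr; ring.
  + apply/anticommJP.
    rewrite -!scalemxAr -!scalemxAl !mulmxDr !mulmxDl !conjJK.
    by move: (conjJ S) (conjJ S^T) => A B; apply/matrixP => a b; rewrite !mxE; ring.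
- split=> //.
  + rewrite !(linearB, linearZ, linearD) /= !conjJ_tr trmxK.
    by move: (conjJ S) (conjJ S^T) => A B; apply/matrixP => a b; rewrite !mxE; ring.
  + apply/anticommJP.
    rewrite -!scalemxAr -!scalemxAl !mulmxDr !mulmxDl !mulmxN !mulNmx !conjJK.
    by move: (conjJ S) (conjJ S^T) => A B; apply/matrixP => a b; rewrite !mxE; ring.
Qed.

Lemma sum_torsion_part S :
  S = torsion_part S chi1 + torsion_part S chi1b + torsion_part S chi2
    + torsion_part S chi2b + torsion_part S chi3 + torsion_part S chi4.
Proof.
rewrite /torsion_part; move: (conjJ S) (conjJ S^T) => A B.
by apply/matrixP => a b; rewrite !mxE; field.
Qed.

Lemma torsion_partD S S' k :
  torsion_part (S + S') k = torsion_part S k + torsion_part S' k.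
Proof.
case: k; rewrite /torsion_part /lamS /muS ?addr0// ?(linearD, mulmxDl, mulmxDr) /=.
- by rewrite mulrDr opprD scalerDl.
- by rewrite mulrDr raddfD.
- rewrite !mulrDr !opprD !scalerDl.
  move: (conjJ S) (conjJ S^T) (conjJ S') (conjJ S'^T) => A B A' B'.
  by apply/matrixP => a b; rewrite !mxE; ring.
- rewrite !mulrDr raddfD/=.
  move: (conjJ S) (conjJ S^T) (conjJ S') (conjJ S'^T) => A B A' B'.
  by apply/matrixP => a b; rewrite !mxE; ring.
- move: (conjJ S) (conjJ S^T) (conjJ S') (conjJ S'^T) => A B A' B'.
  by apply/matrixP => a b; rewrite !mxE; ring.
- move: (conjJ S) (conjJ S^T) (conjJ S') (conjJ S'^T) => A B A' B'.
  by apply/matrixP => a b; rewrite !mxE; ring.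
Qed.

Lemma torsion_part0 k : torsion_part 0 k = 0.
Proof.
by apply: (addrI (torsion_part 0 k)); rewrite -torsion_partD !addr0.
Qed.

Lemma scalar_mx0 : 0%:M = 0 :> 'M[R]_6.
Proof. exact: raddf0. Qed.

Lemma lamS0P S : lamS S = 0 <-> torsion_part S chi1 = 0.
Proof.
rewrite /torsion_part; split=> [->|/eqP]; first by rewrite scale0r.
rewrite scaler_eq0 => /orP[/eqP//|/eqP J0].
have /matrixP/(_ 0 0)/eqP := J_sq.
by rewrite J0 mul0mx !mxE eq_sym oppr_eq0 oner_eq0.
Qed.

Lemma muS0P S : muS S = 0 <-> torsion_part S chi1b = 0.
Proof.
split=> [|/matrixP/(_ 0 0)] /=; last by rewrite !mxE mulr1n.
by move=> ->; rewrite raddf0.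
Qed.

(** The defect of the condition, here S + J S J, is twice the sum of the parts on which the
    condition fails. The same principle governs the next lemmas on anticommutation, symmetry and
    skewness. *)
Lemma commJ_partP S :
  S *m J = J *m S <-> torsion_part S chi3 = 0 /\ torsion_part S chi4 = 0.
Proof.
rewrite commJP; split=> [NS|[T3 T4]].
  have NS' : conjJ S^T = - S^T by rewrite -conjJ_tr NS linearN.
  rewrite /= NS NS'.
  by split; apply/matrixP => a b; rewrite !mxE; ring.
have : conjJ S + S = 2 *: (torsion_part S chi3 + torsion_part S chi4).
  rewrite /torsion_part; move: (conjJ S) (conjJ S^T) => A B.
  by apply/matrixP => a b; rewrite !mxE; field.
by rewrite T3 T4 addr0 scaler0 => /eqP; rewrite addr_eq0 => /eqP.
Qed.

Lemma anticommJ_partP S : S *m J = - (J *m S) <->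
  [/\ torsion_part S chi1 = 0, torsion_part S chi1b = 0,
      torsion_part S chi2 = 0 & torsion_part S chi2b = 0].
Proof.
rewrite anticommJP; split=> [NS|[T1 T1b T2 T2b]].
  have NS' : conjJ S^T = S^T by rewrite -conjJ_tr NS.
  have l0 : lamS S = 0.
    by have := mxtrace_conjJJ S; rewrite NS /lamS; lra.
  have m0 : muS S = 0.
    by have := mxtrace_conjJ S; rewrite NS /muS; lra.
  split; rewrite /= ?NS ?NS' ?l0 ?m0 ?scale0r ?scalar_mx0 ?subrr ?scaler0 ?subr0//.
have : S - conjJ S = 2 *: (torsion_part S chi1 + torsion_part S chi1b
                           + torsion_part S chi2 + torsion_part S chi2b).
  rewrite /torsion_part; move: (conjJ S) (conjJ S^T) => A B.
  by apply/matrixP => a b; rewrite !mxE; field.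
by rewrite T1 T1b T2 T2b !addr0 scaler0 => /eqP; rewrite subr_eq0 => /eqP.
Qed.

Lemma sym_partP S : S^T = S <->
  [/\ torsion_part S chi1 = 0, torsion_part S chi2 = 0 & torsion_part S chi4 = 0].
Proof.
split=> [ST|[T1 T2 T4]].
  have l0 : lamS S = 0.
    by have := mxtrace_trJ S; rewrite ST /lamS; lra.
  by split; rewrite /= ?ST ?l0 ?scale0r ?subrr ?addr0 ?scaler0 ?subr0.
have : S - S^T = 2 *: (torsion_part S chi1 + torsion_part S chi2
                       + torsion_part S chi4).
  rewrite /torsion_part; move: (conjJ S) (conjJ S^T) => A B.
  by apply/matrixP => a b; rewrite !mxE; field.
by rewrite T1 T2 T4 !addr0 scaler0 => /eqP; rewrite subr_eq0 => /eqP.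
Qed.

Lemma skew_partP S : S^T = - S <->
  [/\ torsion_part S chi1b = 0, torsion_part S chi2b = 0 & torsion_part S chi3 = 0].
Proof.
split=> [ST|[T1 T2 T4]].
  have m0 : muS S = 0.
    by have := mxtrace_tr S; rewrite ST linearN /muS/=; lra.
  by split; rewrite /= ?ST ?m0 ?scalar_mx0 ?mulmxN ?mulNmx ?subrr ?addr0 ?scaler0 ?subr0.
have : S + S^T = 2 *: (torsion_part S chi1b + torsion_part S chi2b
                       + torsion_part S chi3).
  rewrite /torsion_part; move: (conjJ S) (conjJ S^T) => A B.
  by apply/matrixP => a b; rewrite !mxE; field.
by rewrite T1 T2 T4 !addr0 scaler0 addrC => /eqP; rewrite addr_eq0 => /eqP.
Qed.

Lemma skew_commJ_partP S :
  (S - S^T) *m J = J *m (S - S^T) <-> torsion_part S chi4 = 0.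
Proof.
rewrite commJP mulmxBr mulmxBl; split=> [NS|]; first by rewrite /= NS subrr scaler0.
rewrite /torsion_part => /eqP; rewrite scaler_eq0 invr_eq0 pnatr_eq0 /=.
by rewrite addrC addr_eq0 => /eqP.
Qed.

Lemma scalar_partP S : S = lamS S *: J + (muS S)%:M <->
  [/\ torsion_part S chi2 = 0, torsion_part S chi2b = 0,
      torsion_part S chi3 = 0 & torsion_part S chi4 = 0].
Proof.
split=> [SE|[T2 T2b T3 T4]]; last first.
  by rewrite [LHS]sum_torsion_part T2 T2b T3 T4 !addr0.
have C : S *m J = J *m S.
  by rewrite SE mulmxDl mulmxDr -scalemxAl -scalemxAr scalar_mxC.
have [-> ->] := (commJ_partP S).1 C.
have /commJP NS := C.
have ST : S^T = - lamS S *: J + (muS S)%:M.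
  by rewrite [in LHS]SE linearD/= linearZ/= J_tr tr_scalar_mx scalerN -scaleNr.
have NS' : conjJ S^T = - S^T by rewrite -conjJ_tr NS linearN.
rewrite /torsion_part/=.
rewrite NS NS'; move: (lamS S) (muS S) SE ST => l m -> ->.
by split=> //; apply/matrixP => a b; rewrite !mxE; field.
Qed.

(** The sum of the classes is direct. For chi1 and chi1b, symmetry and commutation exclude all
    foreign parts but chi2, respectively chi2b; this last part vanishes by comparing S with the sum
    of its parts. *)
Lemma in_chi_part k k' S e : in_chi J k S e -> k' <> k -> torsion_part S k' = 0.
Proof.
have T5 S' : torsion_part S' chi5 = 0 by [].
case: k => [[[r SE] _]|[[r SE] _]|[sk /commJ_partP[T3 T4] trS _]|
            [sy trS /commJ_partP[T3 T4] _]|[sy _ /anticommJ_partP[T1 T1b T2 T2b] _]|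
            [sk /anticommJ_partP[T1 T1b T2 T2b] _]|-> _]; last exact: torsion_part0.
- have lam_r : lamS S = r.
    by rewrite /lamS SE -scalemxAl mxtraceZ mxtrace_JJ; field.
  have /commJ_partP[T3 T4] : S *m J = J *m S by rewrite SE -scalemxAl -scalemxAr.
  have /skew_partP[T1b T2b _] : S^T = - S by rewrite SE linearZ/= J_tr scalerN.
  have := sum_torsion_part S.
  rewrite T1b T2b T3 T4 !addr0 /(torsion_part S chi1) lam_r -SE.
  by rewrite -[LHS]addr0 => /addrI T2; case: k'.
- have mu_r : muS S = r by rewrite /muS SE mxtrace_scalar; field.
  have /commJ_partP[T3 T4] : S *m J = J *m S by rewrite SE scalar_mxC.
  have /sym_partP[T1 T2 _] : S^T = S by rewrite SE tr_scalar_mx.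
  have := sum_torsion_part S.
  rewrite T1 T2 T3 T4 !addr0 add0r /(torsion_part S chi1b) mu_r -SE.
  by rewrite -[LHS]addr0 => /addrI T2b; case: k'.
- have /skew_partP[T1b T2b _] := sk.
  have /lamS0P T1 : lamS S = 0 by rewrite /lamS mxtrace_mulC trS mulr0 oppr0.
  by case: k'.
- have /sym_partP[T1 T2 _] := sy.
  have /muS0P T1b : muS S = 0 by rewrite /muS trS mulr0.
  by case: k'.
- by have /sym_partP[_ _ T4] := sy; case: k'.
- by have /skew_partP[_ _ T3] := sk; case: k'.
Qed.

Lemma in_chi_form k S e : in_chi J k S e -> k <> chi5 -> e = 0.
Proof. by case: k => [[_ ->]|[_ ->]|[_ _ _ ->]|[_ _ _ ->]|[_ _ _ ->]|[_ _ ->]|_ []]. Qed.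

(** Membership as a proposition that computes to a disjunction of equalities, so that non-membership
    in an explicit list is settled by discriminating constructors. *)
Fixpoint chi_mem (k : torsion_class) (ks : seq torsion_class) : Prop :=
  if ks is k' :: ks' then k = k' \/ chi_mem k ks' else False.

Lemma in_chi_sumP ks S e : in_chi_sum J ks S e ->
  (forall k, ~ chi_mem k ks -> torsion_part S k = 0) /\ (~ chi_mem chi5 ks -> e = 0).
Proof.
case=> T [t [Tt -> ->]]; elim: ks => [|k ks [ihS ihe]].
  by rewrite !big_nil; split=> // k _; exact: torsion_part0.
rewrite !big_cons; split=> [k' /= k'ks|/= nks].
  rewrite torsion_partD ihS => [|h]; last by apply: k'ks; right.
  by rewrite addr0; apply: in_chi_part (Tt k) _ => h; apply: k'ks; left.
rewrite ihe => [|h]; last by apply: nks; right.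
by rewrite addr0; apply: in_chi_form (Tt k) _ => h; apply: nks; left.
Qed.

(** The projections of S serve as components, and eta is carried by chi5 alone. *)
Lemma in_chi_sum_part ks S e :
  S = \sum_(k <- ks) torsion_part S k ->
  (e = \sum_(k <- ks) if k is chi5 then e else 0) -> in_chi_sum J ks S e.
Proof.
move=> SE eE; exists (torsion_part S), (fun k => if k is chi5 then e else 0).
by split=> // k; have := in_chi_torsion_part S k; case: k.
Qed.

End TorsionDecomposition.

Ltac chi_zero := match goal with
  | h : _ = 0 |- _ => rewrite h
  end.

(** Proves that (S, eta) lies in the sum over an explicit list if and only if the parts missing from
    the list vanish. Forwards this is directness of the sum; backwards S is replaced by the sum of
    its six parts, from which the vanishing ones are erased. *)
Ltac in_chi_sum_tac J J_sq J_tr :=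
  let h := fresh in let he := fresh in split; intro h;
  [ apply (in_chi_sumP _ J_sq J_tr) in h; destruct h as [h he];
    repeat split; first [apply h | apply he]; simpl; intuition discriminate
  | decompose [and] h;
    apply: (in_chi_sum_part _ J_sq J_tr); rewrite !big_cons big_nil;
    [ apply: etrans (sum_torsion_part J _) _; repeat chi_zero;
      by rewrite ?(addr0, add0r) ?addrA
    | by rewrite ?addr0 ?add0r ] ].

(** * The spinorial conditions at a point, with a linear map [n] in the place of X -> nabla_X phi *)

Section PointwiseClasses.
Context {R : realType} (C : clifford_module R).
Variables (phi : 'cV[R]_8) (J S : 'M[R]_6) (n : 'rV[R]_6 -> 'cV[R]_8).
Local Notation j := (volj C).
Local Notation cl := (cliff C).
Local Notation jphi := (j *m phi).
Local Notation eta X := (ip (n X) jphi).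
Local Notation D := (\sum_a C a *m n (delta_mx 0 a)).
Hypotheses (phi_unit : ip phi phi = 1)
  (J_phi : forall X, cl (X *m J) *m phi = j *m (cl X *m phi))
  (S_phi : forall X, n X = eta X *: jphi + cl (X *m S) *m phi)
  (n_linear : forall X, n X = \sum_a X 0 a *: n (delta_mx 0 a)).
Implicit Types X Y : 'rV[R]_6.

Local Notation T := (torsion_part J S).
Let e : 'cV[R]_6 := \col_a eta (delta_mx 0 a).
Let J_sq : J *m J = - 1%:M := Jphi_sq C _ _ phi_unit ltr01 _ J_phi.
Let J_tr : J^T = - J := Jphi_tr C _ _ phi_unit ltr01 _ J_phi.
Let dotJ X Y : dot X (Y *m J) = - dot (X *m J) Y.
Proof. by rewrite -[J in LHS]trmxK J_tr dot_mulmx mulmxN dotNl. Qed.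

Lemma eta_linear X : eta X = \sum_a X 0 a * eta (delta_mx 0 a).
Proof. by rewrite n_linear ip_suml; apply: eq_bigr => a _; rewrite ipZl. Qed.

Lemma eta0P : e = 0 <-> forall X, eta X = 0.
Proof.
split=> [/matrixP e0 X|h]; last by apply/matrixP => a b; rewrite !mxE h.
rewrite eta_linear big1// => a _.
by have := e0 a 0; rewrite !mxE => ->; rewrite mulr0.
Qed.

Lemma ip_nabla_cliff X Y : ip (n X) (cl Y *m phi) = dot (X *m S) Y.
Proof.
rewrite S_phi ipDl ipZl [ip jphi _]ipC ip_cliff_jphi mulr0 add0r.
by rewrite (ip_cliff_cliff C _ _ phi_unit) mul1r.
Qed.

Lemma ip_cliff_nabla X Y : ip (cl Y *m n X) phi = - dot (X *m S) Y.
Proof. by rewrite ip_cliff ip_nabla_cliff. Qed.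

(** Y j(phi) = -(JY) phi, so that pairing with j(phi) sees S J where pairing with phi sees S. *)
Lemma ip_cliff_nabla_jphi X Y : ip (cl Y *m n X) jphi = - dot (X *m (S *m J)) Y.
Proof.
rewrite ip_cliff (cliff_jphi C _ _ J_phi) mulNmx ipNr opprK.
by rewrite ip_nabla_cliff dotJ mulmxA.
Qed.

Lemma nabla_commJP : (forall X Y, ip (cl (Y *m J) *m n X) phi
    = - ip (cl Y *m n (X *m J)) phi) <-> S *m J = J *m S.
Proof.
have E X Y : ip (cl (Y *m J) *m n X) phi = dot (X *m (S *m J)) Y.
  by rewrite ip_cliff_nabla dotJ opprK mulmxA.
have E' X Y : ip (cl Y *m n (X *m J)) phi = - dot (X *m (J *m S)) Y.
  by rewrite ip_cliff_nabla mulmxA.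
split=> [h|h X Y]; last by rewrite E E' opprK h.
by apply: dot_mx_inj => X Y; rewrite -E h E' opprK.
Qed.

Lemma nabla_anticommJP : (forall X Y, ip (cl (Y *m J) *m n X) phi
    = ip (cl Y *m n (X *m J)) phi) <-> S *m J = - (J *m S).
Proof.
have E X Y : ip (cl (Y *m J) *m n X) phi = dot (X *m (S *m J)) Y.
  by rewrite ip_cliff_nabla dotJ opprK mulmxA.
have E' X Y : ip (cl Y *m n (X *m J)) phi = dot (X *m - (J *m S)) Y.
  by rewrite ip_cliff_nabla mulmxN dotNl mulmxA.
split=> [h|h X Y]; last by rewrite E E' h.
by apply: dot_mx_inj => X Y; rewrite -E h E'.
Qed.

Lemma nabla_symP : (forall X Y, ip (cl Y *m n X) jphi = ip (cl X *m n Y) jphi)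
  <-> (S *m J)^T = S *m J.
Proof.
have E X Y : ip (cl Y *m n X) jphi = - dot (X *m (S *m J)) Y.
  exact: ip_cliff_nabla_jphi.
split=> [h|h X Y].
  apply: dot_mx_inj => X Y; rewrite -dot_mulmx trmxK dotC.
  by apply: oppr_inj; rewrite -!E h.
by rewrite !E -[in RHS]h -[in RHS]dot_mulmx trmxK dotC.
Qed.

Lemma nabla_skewP : (forall X Y, ip (cl Y *m n X) jphi = - ip (cl X *m n Y) jphi)
  <-> (S *m J)^T = - (S *m J).
Proof.
have E X Y : ip (cl Y *m n X) jphi = - dot (X *m (S *m J)) Y.
  exact: ip_cliff_nabla_jphi.
split=> [h|h X Y].
  apply: dot_mx_inj => X Y; rewrite -dot_mulmx trmxK dotC mulmxN dotNl.
  by rewrite -E h E opprK.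
by rewrite !E -[in LHS]dot_mulmx h mulmxN [in LHS]dotC dotNl.
Qed.

(** Uniqueness of the pair (S, eta): the X phi are orthogonal to j(phi), and X phi determines X. *)
Lemma nabla_eqP (M : 'M[R]_6) : (forall X, n X = cl (X *m M) *m phi)
  <-> S = M /\ forall X, eta X = 0.
Proof.
split=> [h|[SM e0] X]; last by rewrite S_phi e0 scale0r add0r SM.
have e0 X : eta X = 0 by rewrite h ip_cliff_jphi.
split=> //; apply: mulmx_rV_inj => X.
apply: (cliff_phi_inj C _ _ phi_unit ltr01).
by rewrite -h S_phi e0 scale0r add0r.
Qed.

Lemma dirac_phi : - (6^-1 * ip D phi) = muS S.
Proof.
rewrite ip_suml /muS; under eq_bigr do rewrite -cliff_delta ip_cliff_nabla.
rewrite sumrN mulrN opprK /mxtrace; congr (_ * _); apply: eq_bigr => a _.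
by rewrite dotC dot_delta -rowE mxE.
Qed.

Lemma dirac_jphi : 6^-1 * ip D jphi = lamS J S.
Proof.
rewrite ip_suml /lamS; under eq_bigr do rewrite -cliff_delta ip_cliff_nabla_jphi.
rewrite sumrN mulrN /mxtrace; congr (- (_ * _)); apply: eq_bigr => a _.
by rewrite dotC dot_delta -rowE mxE.
Qed.

(** The symmetric part of S contributes only a multiple of phi, orthogonal to TM phi; what counts is
    the skew part, half of S - S^T. *)
Lemma dirac_cliff_aux X : ip (cliff2 C S *m phi) (cl X *m phi)
   = 2^-1 * ip (cliff2 C (S - S^T) *m phi) (cl X *m phi).
Proof.
have SS : cliff2 C S^T = (- 2 * \tr S)%:M - cliff2 C S.
  by rewrite -(cliff2_addtr C) addrAC subrr add0r.
have -> : cliff2 C (S - S^T) = 2 *: cliff2 C S - (- 2 * \tr S)%:M.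
  by rewrite linearB/= SS opprB addrA -mulr2n scaler_nat.
rewrite mulmxBl mul_scalar_mx ipDl ipNl ipZl (ipC phi) ip_cliff_phi.
by rewrite mulr0 subr0 -scalemxAl ipZl mulrA mulVf ?mul1r// pnatr_eq0.
Qed.

Lemma dirac_cliff2 : D = \sum_a eta (delta_mx 0 a) *: (C a *m jphi)
  + cliff2 C S *m phi.
Proof.
rewrite /cliff2 mulmx_suml -big_split; apply: eq_bigr => a _ /=.
by rewrite {1}S_phi mulmxDr -scalemxAr -rowE mulmxA.
Qed.

Lemma dirac_cliff : (forall X, eta X = 0) ->
  (forall X, ip D (cl X *m phi) = 0) <-> T chi4 = 0.
Proof.
move=> e0; rewrite -(skew_commJ_partP J J_sq).
rewrite -(cliff2_phi_orthP C _ _ phi_unit ltr01 _ J_phi); last first.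
  by rewrite linearB/= trmxK opprB.
have E X : ip D (cl X *m phi)
    = 2^-1 * ip (cliff2 C (S - S^T) *m phi) (cl X *m phi).
  rewrite -dirac_cliff_aux dirac_cliff2 big1 ?add0r// => a _.
  by rewrite e0 scale0r.
split=> h X; have := h X; rewrite E; last by move=> ->; rewrite mulr0.
by move/eqP; rewrite mulf_eq0 invr_eq0 pnatr_eq0 => /eqP.
Qed.

(** The e_a j(phi) are orthonormal as well, so the eta part of D phi contributes exactly eta(X). The
    condition therefore says that the rest of D phi has no component in TM phi, as in
    [dirac_cliff]. *)
Lemma dirac_cliff_jphi :
  (forall X, ip D (cl X *m jphi) = eta X) <-> T chi4 = 0.
Proof.
rewrite -(skew_commJ_partP J J_sq).
rewrite -(cliff2_phi_orthP C _ _ phi_unit ltr01 _ J_phi); last first.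
  by rewrite linearB/= trmxK opprB.
have E X : ip D (cl X *m jphi)
    = eta X - 2^-1 * ip (cliff2 C (S - S^T) *m phi) (cl (X *m J) *m phi).
  rewrite -dirac_cliff_aux dirac_cliff2 ipDl; congr (_ + _); last first.
    by rewrite (cliff_jphi C _ _ J_phi) mulNmx ipNr.
  rewrite ip_suml eta_linear; apply: eq_bigr => a _; rewrite ipZl mulrC.
  congr (_ * _); rewrite -cliff_delta (ip_cliff_cliff C _ 1) ?mul1r ?dot_delta//.
  by rewrite (ip_jphi_jphi C _ _ phi_unit).
split=> h X; last by rewrite E h mulr0 subr0.
have YJ : - (X *m J) *m J = X.
  by rewrite mulNmx -mulmxA J_sq mulmxN mulmx1 opprK.
by have := h (- (X *m J)); rewrite E YJ; lra.
Qed.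

Lemma dirac0P : (forall X, eta X = 0) ->
  D = 0 <-> [/\ T chi1 = 0, T chi1b = 0 & T chi4 = 0].
Proof.
move=> e0; split=> [D0|].
  have /muS0P T1b : muS S = 0 by rewrite -dirac_phi D0 ip0l mulr0 oppr0.
  have /(lamS0P _ J_sq) T1 : lamS J S = 0 by rewrite -dirac_jphi D0 ip0l mulr0.
  by split=> //; apply/dirac_cliff => // X; rewrite D0 ip0l.
case=> /(lamS0P _ J_sq) l0 /muS0P m0 /(dirac_cliff e0) D0.
apply: (spinor_ext C _ _ phi_unit ltr01) => //.
  by have := dirac_phi; rewrite m0; lra.
by have := dirac_jphi; rewrite l0; lra.
Qed.

(** The transpose of S J is -J S^T. Commutation or anticommutation brings J to the left of S as
    well, where it can be cancelled: this exchanges symmetric and skew in the commuting case and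
    preserves them in the anticommuting one. *)
Lemma sym_comm : S *m J = J *m S -> (S *m J)^T = S *m J <-> S^T = - S.
Proof.
move=> SJ; rewrite trmx_mul J_tr SJ mulNmx; split=> [h|->]; last by rewrite mulmxN opprK.
have /(congr1 (mulmx J)) := h.
rewrite mulmxN !mulmxA J_sq !mulNmx !mul1mx opprK.
exact.
Qed.

Lemma sym_anticomm : S *m J = - (J *m S) -> (S *m J)^T = S *m J <-> S^T = S.
Proof.
move=> SJ; rewrite trmx_mul J_tr SJ mulNmx; split=> [|->//].
move=> /oppr_inj /(congr1 (mulmx J)).
by rewrite !mulmxA J_sq !mulNmx !mul1mx => /oppr_inj.
Qed.

Lemma skew_comm : S *m J = J *m S -> (S *m J)^T = - (S *m J) <-> S^T = S.
Proof.
move=> SJ; rewrite trmx_mul J_tr SJ mulNmx; split=> [|->//].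
move=> /oppr_inj /(congr1 (mulmx J)).
by rewrite !mulmxA J_sq !mulNmx !mul1mx => /oppr_inj.
Qed.

Lemma skew_anticomm : S *m J = - (J *m S) -> (S *m J)^T = - (S *m J) <-> S^T = - S.
Proof.
move=> SJ; rewrite trmx_mul J_tr SJ mulNmx opprK; split=> [h|->]; last by rewrite mulmxN opprK.
have /(congr1 (mulmx J)) := h.
rewrite mulmxN !mulmxA J_sq !mulNmx !mul1mx opprK.
exact.
Qed.

Lemma nabla_swapP : (forall X Y, ip (cl X *m n Y) phi = ip (cl Y *m n X) phi)
  <-> S^T = S.
Proof.
split=> [h|h X Y].
  apply: dot_mx_inj => X Y; rewrite -dot_mulmx trmxK dotC.
  by apply: oppr_inj; rewrite -!ip_cliff_nabla h.
by rewrite !ip_cliff_nabla -[in RHS]h -[in RHS]dot_mulmx trmxK dotC.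
Qed.

Local Notation nabla_comm := (forall X Y,
  ip (cl (Y *m J) *m n X) phi = - ip (cl Y *m n (X *m J)) phi).
Local Notation nabla_anticomm := (forall X Y,
  ip (cl (Y *m J) *m n X) phi = ip (cl Y *m n (X *m J)) phi).
Local Notation nabla_sym := (forall X Y,
  ip (cl Y *m n X) jphi = ip (cl X *m n Y) jphi).
Local Notation nabla_skew := (forall X Y,
  ip (cl Y *m n X) jphi = - ip (cl X *m n Y) jphi).
Local Notation lam := (6^-1 * ip D jphi).
Local Notation mu := (- (6^-1 * ip D phi)).
Local Notation eta0 := (forall X, eta X = 0).

Let commE : nabla_comm <-> T chi3 = 0 /\ T chi4 = 0.
Proof. exact: iff_trans nabla_commJP (commJ_partP _ J_sq J_tr S). Qed.

Let anticommE : nabla_anticomm <->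
  [/\ T chi1 = 0, T chi1b = 0, T chi2 = 0 & T chi2b = 0].
Proof. exact: iff_trans nabla_anticommJP (anticommJ_partP _ J_sq J_tr S). Qed.

Let comm_symE : nabla_comm -> nabla_sym <->
  [/\ T chi1b = 0, T chi2b = 0 & T chi3 = 0].
Proof.
move=> /nabla_commJP SJ; apply: iff_trans nabla_symP _.
exact: iff_trans (sym_comm SJ) (skew_partP J S).
Qed.

Let comm_skewE : nabla_comm -> nabla_skew <->
  [/\ T chi1 = 0, T chi2 = 0 & T chi4 = 0].
Proof.
move=> /nabla_commJP SJ; apply: iff_trans nabla_skewP _.
exact: iff_trans (skew_comm SJ) (sym_partP J J_tr S).
Qed.

Let anticomm_symE : nabla_anticomm -> nabla_sym <->
  [/\ T chi1 = 0, T chi2 = 0 & T chi4 = 0].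
Proof.
move=> /nabla_anticommJP SJ; apply: iff_trans nabla_symP _.
exact: iff_trans (sym_anticomm SJ) (sym_partP J J_tr S).
Qed.

Let anticomm_skewE : nabla_anticomm -> nabla_skew <->
  [/\ T chi1b = 0, T chi2b = 0 & T chi3 = 0].
Proof.
move=> /nabla_anticommJP SJ; apply: iff_trans nabla_skewP _.
exact: iff_trans (skew_anticomm SJ) (skew_partP J S).
Qed.

Let lam0E : lam = 0 <-> T chi1 = 0.
Proof. by rewrite dirac_jphi; exact: lamS0P. Qed.

Let mu0E : mu = 0 <-> T chi1b = 0.
Proof. by rewrite dirac_phi; exact: muS0P. Qed.

Let swapE := iff_trans nabla_swapP (sym_partP J J_tr S).

(** The right-hand side is (lambda J + mu Id)(X) phi, so the equation says that eta = 0 and that S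
    reduces to its chi1 and chi1b parts. *)
Lemma nabla_scalarP :
  (forall X, n X = - lam *: (cl X *m jphi) + mu *: (cl X *m phi)) <->
  [/\ T chi2 = 0, T chi2b = 0, T chi3 = 0, T chi4 = 0 & eta0].
Proof.
have E X : - lam *: (cl X *m jphi) + mu *: (cl X *m phi)
    = cl (X *m (lamS J S *: J + (muS S)%:M)) *m phi.
  rewrite dirac_jphi dirac_phi (cliff_jphi C _ _ J_phi) mulNmx scaleNr scalerN opprK.
  rewrite mulmxDr -scalemxAr cliffD cliffZ mulmxDl -scalemxAl.
  by rewrite mul_mx_scalar cliffZ -scalemxAl.
split=> [h|[T2 T2b T3 T4 e0] X].
  have /nabla_eqP[SE e0] : forall X, n X
      = cl (X *m (lamS J S *: J + (muS S)%:M)) *m phi by move=> X; rewrite -E.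
  by have [] := (scalar_partP _ J_sq J_tr S).1 SE.
rewrite E; move: X; apply/nabla_eqP; split=> //.
by apply/(scalar_partP _ J_sq J_tr).
Qed.

Lemma nabla_lamP : (forall X, n X = - lam *: (cl X *m jphi)) <->
  [/\ T chi1b = 0, T chi2 = 0, T chi2b = 0, T chi3 = 0 & T chi4 = 0 /\ eta0].
Proof.
split=> [h|[T1b T2 T2b T3 [T4 e0]] X].
  have : forall X, n X = cl (X *m (lamS J S *: J)) *m phi.
    move=> X; rewrite h dirac_jphi (cliff_jphi C _ _ J_phi) mulNmx scalerN.
    by rewrite scaleNr opprK -scalemxAr cliffZ -scalemxAl.
  case/nabla_eqP => SE e0.
  have /(skew_partP J)[T1b _ _] : S^T = - S.
    by rewrite SE linearZ/= J_tr scalerN.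
  have : S = lamS J S *: J + (muS S)%:M.
    by move/muS0P: T1b ->; rewrite scalar_mx0 addr0.
  by case/(scalar_partP _ J_sq J_tr) => *.
have := (nabla_scalarP.2 (And5 T2 T2b T3 T4 e0)) X.
by move/mu0E: T1b => ->; rewrite scale0r addr0.
Qed.

Lemma nabla_muP : (forall X, n X = mu *: (cl X *m phi)) <->
  [/\ T chi1 = 0, T chi2 = 0, T chi2b = 0, T chi3 = 0 & T chi4 = 0 /\ eta0].
Proof.
split=> [h|[T1 T2 T2b T3 [T4 e0]] X].
  have : forall X, n X = cl (X *m (muS S)%:M) *m phi.
    by move=> X; rewrite h dirac_phi mul_mx_scalar cliffZ -scalemxAl.
  case/nabla_eqP => SE e0.
  have /(sym_partP J J_tr)[T1 _ _] : S^T = S by rewrite SE tr_scalar_mx.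
  have : S = lamS J S *: J + (muS S)%:M.
    by move/(lamS0P _ J_sq): T1 ->; rewrite scale0r add0r.
  by case/(scalar_partP _ J_sq J_tr) => *.
have := (nabla_scalarP.2 (And5 T2 T2b T3 T4 e0)) X.
by move/lam0E: T1 => ->; rewrite oppr0 scale0r add0r.
Qed.

Lemma nabla_etaP : (forall X, n X = eta X *: jphi) <->
  T chi1 = 0 /\ T chi1b = 0 /\ T chi2 = 0 /\ T chi2b = 0 /\ T chi3 = 0 /\ T chi4 = 0.
Proof.
split=> [h|[T1 [T1b [T2 [T2b [T3 T4]]]]] X].
  suff -> : S = 0 by do !split; exact: torsion_part0.
  apply: mulmx_rV_inj => X; apply: (cliff_phi_inj C _ _ phi_unit ltr01).
  apply: (addrI (eta X *: jphi)).
  by rewrite -S_phi mulmx0 cliff0 mul0mx addr0.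
have S0 : S = 0.
  by rewrite [LHS](sum_torsion_part J S) T1 T1b T2 T2b T3 T4 !addr0.
by rewrite {1}S_phi [in cl _]S0 mulmx0 cliff0 mul0mx addr0.
Qed.

(** [Q] lists the vanishing of the missing parts. After this step, the comparison of [Q] with the
    spinorial condition is propositional. *)
Ltac class_tac Q := apply: (@iff_trans _ Q); [in_chi_sum_tac J J_sq J_tr|].

Lemma chi1P : in_chi_sum J [:: chi1] S e <->
  (forall X, n X = - lam *: (cl X *m jphi)).
Proof.
class_tac (T chi1b = 0 /\ T chi2 = 0 /\ T chi2b = 0 /\ T chi3 = 0 /\ T chi4 = 0 /\ e = 0).
have := nabla_lamP; have := eta0P; dtauto.
Qed.

Lemma chi1bP : in_chi_sum J [:: chi1b] S e <->
  (forall X, n X = mu *: (cl X *m phi)).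
Proof.
class_tac (T chi1 = 0 /\ T chi2 = 0 /\ T chi2b = 0 /\ T chi3 = 0 /\ T chi4 = 0 /\ e = 0).
have := nabla_muP; have := eta0P; dtauto.
Qed.

Lemma chi2P : in_chi_sum J [:: chi2] S e <->
  [/\ nabla_comm, nabla_sym, lam = 0 & eta0].
Proof.
class_tac (T chi1 = 0 /\ T chi1b = 0 /\ T chi2b = 0 /\ T chi3 = 0 /\ T chi4 = 0 /\ e = 0).
have := commE; have := comm_symE; have := lam0E; have := eta0P; dtauto.
Qed.

Lemma chi2bP : in_chi_sum J [:: chi2b] S e <->
  [/\ nabla_comm, nabla_skew, mu = 0 & eta0].
Proof.
class_tac (T chi1 = 0 /\ T chi1b = 0 /\ T chi2 = 0 /\ T chi3 = 0 /\ T chi4 = 0 /\ e = 0).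
have := commE; have := comm_skewE; have := mu0E; have := eta0P; dtauto.
Qed.

Lemma chi3P : in_chi_sum J [:: chi3] S e <->
  [/\ nabla_anticomm, nabla_sym & eta0].
Proof.
class_tac (T chi1 = 0 /\ T chi1b = 0 /\ T chi2 = 0 /\ T chi2b = 0 /\ T chi4 = 0 /\ e = 0).
have := anticommE; have := anticomm_symE; have := eta0P; dtauto.
Qed.

Lemma chi4P : in_chi_sum J [:: chi4] S e <->
  [/\ nabla_anticomm, nabla_skew & eta0].
Proof.
class_tac (T chi1 = 0 /\ T chi1b = 0 /\ T chi2 = 0 /\ T chi2b = 0 /\ T chi3 = 0 /\ e = 0).
have := anticommE; have := anticomm_skewE; have := eta0P; dtauto.
Qed.

Lemma chi5P : in_chi_sum J [:: chi5] S e <->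
  (forall X, n X = eta X *: jphi).
Proof.
class_tac (T chi1 = 0 /\ T chi1b = 0 /\ T chi2 = 0 /\ T chi2b = 0 /\ T chi3 = 0 /\ T chi4 = 0).
have := nabla_etaP; dtauto.
Qed.

Lemma chi11bP : in_chi_sum J [:: chi1; chi1b] S e <->
  (forall X, n X = - lam *: (cl X *m jphi) + mu *: (cl X *m phi)).
Proof.
class_tac (T chi2 = 0 /\ T chi2b = 0 /\ T chi3 = 0 /\ T chi4 = 0 /\ e = 0).
have := nabla_scalarP; have := eta0P; dtauto.
Qed.

Lemma chi22bP : in_chi_sum J [:: chi2; chi2b] S e <->
  [/\ nabla_comm, lam = 0, mu = 0 & eta0].
Proof.
class_tac (T chi1 = 0 /\ T chi1b = 0 /\ T chi3 = 0 /\ T chi4 = 0 /\ e = 0).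
have := commE; have := lam0E; have := mu0E; have := eta0P; dtauto.
Qed.

Lemma chi22b5P : in_chi_sum J [:: chi2; chi2b; chi5] S e <->
  [/\ nabla_comm, lam = 0 & mu = 0].
Proof.
class_tac (T chi1 = 0 /\ T chi1b = 0 /\ T chi3 = 0 /\ T chi4 = 0).
have := commE; have := lam0E; have := mu0E; dtauto.
Qed.

Lemma chi11b22bP : in_chi_sum J [:: chi1; chi1b; chi2; chi2b] S e <->
  nabla_comm /\ eta0.
Proof.
class_tac (T chi3 = 0 /\ T chi4 = 0 /\ e = 0).
have := commE; have := eta0P; dtauto.
Qed.

Lemma chi11b22b5P : in_chi_sum J [:: chi1; chi1b; chi2; chi2b; chi5] S e <->
  nabla_comm.
Proof.
class_tac (T chi3 = 0 /\ T chi4 = 0).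
have := commE; dtauto.
Qed.

Lemma chi22b3P : in_chi_sum J [:: chi2; chi2b; chi3] S e <->
  D = 0 /\ eta0.
Proof.
class_tac (T chi1 = 0 /\ T chi1b = 0 /\ T chi4 = 0 /\ e = 0).
have := dirac0P; have := eta0P; dtauto.
Qed.

Lemma chi11b22b3P : in_chi_sum J [:: chi1; chi1b; chi2; chi2b; chi3] S e <->
  (forall X, ip D (cl X *m phi) = 0) /\ eta0.
Proof.
class_tac (T chi4 = 0 /\ e = 0).
have := dirac_cliff; have := eta0P; dtauto.
Qed.

Lemma chi11b22b34P : in_chi_sum J [:: chi1; chi1b; chi2; chi2b; chi3; chi4] S e <->
  eta0.
Proof.
class_tac (e = 0).
have := eta0P; dtauto.
Qed.

Lemma chi22b35P : in_chi_sum J [:: chi2; chi2b; chi3; chi5] S e <->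
  [/\ forall X, ip D (cl X *m jphi) = eta X, lam = 0 & mu = 0].
Proof.
class_tac (T chi1 = 0 /\ T chi1b = 0 /\ T chi4 = 0).
have := dirac_cliff_jphi; have := lam0E; have := mu0E; dtauto.
Qed.

Lemma chi11b22b35P : in_chi_sum J [:: chi1; chi1b; chi2; chi2b; chi3; chi5] S e <->
  (forall X, ip D (cl X *m jphi) = eta X).
Proof.
class_tac (T chi4 = 0).
have := dirac_cliff_jphi; dtauto.
Qed.

Lemma chi34P : in_chi_sum J [:: chi3; chi4] S e <->
  nabla_anticomm /\ eta0.
Proof.
class_tac (T chi1 = 0 /\ T chi1b = 0 /\ T chi2 = 0 /\ T chi2b = 0 /\ e = 0).
have := anticommE; have := eta0P; dtauto.
Qed.

Lemma chi345P : in_chi_sum J [:: chi3; chi4; chi5] S e <->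
  nabla_anticomm.
Proof.
class_tac (T chi1 = 0 /\ T chi1b = 0 /\ T chi2 = 0 /\ T chi2b = 0).
have := anticommE; dtauto.
Qed.

Lemma chi22b345P : in_chi_sum J [:: chi2; chi2b; chi3; chi4; chi5] S e <->
  lam = 0 /\ mu = 0.
Proof.
class_tac (T chi1 = 0 /\ T chi1b = 0).
have := lam0E; have := mu0E; dtauto.
Qed.

Lemma chi1b2b3P : in_chi_sum J [:: chi1b; chi2b; chi3] S e <->
  (forall X Y, ip (cl X *m n Y) phi = ip (cl Y *m n X) phi) /\ eta0.
Proof.
class_tac (T chi1 = 0 /\ T chi2 = 0 /\ T chi4 = 0 /\ e = 0).
have := swapE; have := eta0P; dtauto.
Qed.

End PointwiseClasses.

(** * Derivatives on open subsets of R^6 *)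

Lemma is_derive_line (R : numFieldType) (V W : normedModType R) (f : V -> W)
  (c u : V) (t : R) : derivable f (c + t *: u) u ->
  is_derive t (1 : R) (fun s : R => f (c + s *: u)) ('D_u f (c + t *: u)).
Proof.
rewrite /derivable => dfu.
have E : (fun h : R => h^-1 *: (((fun s : R => f (c + s *: u)) \o shift t) (h *: (1 : R))
      - f (c + t *: u)))
    = (fun h => h^-1 *: ((f \o shift (c + t *: u)) (h *: u) - f (c + t *: u))).
  apply/funext => h /=; congr (_ *: (f _ - _)).
  by rewrite [h *: 1]mulr1 scalerDl addrCA.
by apply: DeriveDef; rewrite /derivable /derive E.
Qed.

Section Derivatives.
Context {R : realType}.
Implicit Types u v x c : 'rV[R]_6.

Lemma derive_chain (f : 'rV[R]_6 -> R) (T : 'rV[R]_6 -> 'rV[R]_6) x v :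
  differentiable T x -> differentiable f (T x) ->
  is_derive x v (f \o T) ('D_('D_v T x) f (T x)).
Proof.
move=> dT df; have fT : differentiable (f \o T) x by exact: differentiable_comp.
apply: DeriveDef; first exact: diff_derivable.
by rewrite deriveE// diff_comp//= !deriveE.
Qed.

Lemma derive_linear (W : normedModType R) (f : 'rV[R]_6 -> W) x v :
  differentiable f x ->
  'D_v f x = \sum_a v 0 a *: 'D_(delta_mx 0 a) f x.
Proof.
move=> df; rewrite deriveE// {1}[v]row_sum_delta linear_sum.
by apply: eq_bigr => a _; rewrite linearZ/= deriveE.
Qed.

Lemma is_derive_along (f : 'rV[R]_6 -> R) c u (t df : R) :
  is_derive (c + t *: u) u f df ->
  is_derive t (1 : R) (fun s : R => f (c + s *: u)) df.
Proof. by case=> dfu <-; exact: is_derive_line. Qed.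

(** The mean value theorem is applied twice: along u to the increment of f in the direction v, then
    along v to g. *)
Lemma second_difference (f g k : 'rV[R]_6 -> R) x u v (s : R) : 0 < s ->
  (forall t r, 0 <= t <= s -> 0 <= r <= s ->
    is_derive (x + t *: u + r *: v) u f (g (x + t *: u + r *: v))) ->
  (forall t r, 0 <= t <= s -> 0 <= r <= s ->
    is_derive (x + t *: u + r *: v) v g (k (x + t *: u + r *: v))) ->
  exists t r, [/\ 0 <= t <= s, 0 <= r <= s &
    f (x + s *: u + s *: v) - f (x + s *: u) - (f (x + s *: v) - f x) =
    s * s * k (x + t *: u + r *: v)].
Proof.
move=> s0 df dg.
pose h (t : R) := f ((x + s *: v) + t *: u) - f (x + t *: u).
have s00 : 0 <= s <= s by rewrite lexx ltW.
have z00 : 0 <= (0 : R) <= s by rewrite lexx ltW.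
have hd (t : R) : 0 <= t <= s -> is_derive t (1 : R) h
    (g (x + t *: u + s *: v) - g (x + t *: u)).
  move=> ts; have := df t s ts s00; have := df t 0 ts z00.
  rewrite scale0r addr0 addrAC => d0 d1.
  exact: (is_deriveB (is_derive_along _ _ _ _ _ d1) (is_derive_along _ _ _ _ _ d0)).
have [t] : exists2 t, t \in `]0, s[ & h s - h 0 =
    (g (x + t *: u + s *: v) - g (x + t *: u)) * (s - 0).
  apply: MVT => //.
    by move=> t /itvP ts; apply: hd; rewrite !ltW// ts.
  apply: derivable_within_continuous => t; rewrite in_itv/= => ts.
  by have [] := hd t ts.
rewrite in_itv/= => /andP[t0 ts]; have tt : 0 <= t <= s by rewrite !ltW.
rewrite subr0 => E1.
pose h' (r : R) := g (x + t *: u + r *: v).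
have h'd (r : R) : 0 <= r <= s -> is_derive r (1 : R) h' (k (x + t *: u + r *: v)).
  by move=> rs; apply: is_derive_along; exact: dg.
have [r] : exists2 r, r \in `]0, s[ & h' s - h' 0
    = k (x + t *: u + r *: v) * (s - 0).
  apply: MVT => //.
    by move=> r /itvP rs; apply: h'd; rewrite !ltW// rs.
  apply: derivable_within_continuous => r; rewrite in_itv/= => rs.
  by have [] := h'd r rs.
rewrite in_itv/= => /andP[r0 rs]; rewrite /h' scale0r addr0 subr0 => E2.
exists t, r; split; rewrite ?(ltW t0) ?(ltW ts) ?(ltW r0) ?(ltW rs)//.
move: E1; rewrite /h E2 scale0r !addr0 => E1.
have -> : x + s *: u + s *: v = x + s *: v + s *: u by rewrite addrAC.
by rewrite E1 -mulrA mulrC.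
Qed.

Lemma near_box (P : set 'rV[R]_6) x u v : (\forall y \near x, P y) ->
  exists2 s : R, 0 < s & forall t r, 0 <= t <= s -> 0 <= r <= s ->
    P (x + t *: u + r *: v).
Proof.
move=> /nbhs_ballP[d /= d0 xP].
(* The summand 1 keeps [k] positive even if u and v vanish. With side d / 2 / k, the box stays
   within distance d / 2 of x. *)
pose k := `|u| + `|v| + 1.
have k0 : 0 < k by rewrite /k; have := normr_ge0 u; have := normr_ge0 v; lra.
exists (d / 2 / k) => [|t r /andP[t0 ts] /andP[r0 rs]]; first by rewrite !divr_gt0.
apply: xP; rewrite -ball_normE /= -addrA opprD addrA subrr add0r normrN.
apply: le_lt_trans (ler_normD _ _) _; rewrite !normrZ !ger0_norm//.
apply: le_lt_trans (_ : d / 2 < d); last by lra.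
have -> : d / 2 = d / 2 / k * k by rewrite divfK// gt_eqF.
set s := d / 2 / k in ts rs *; have s0 : 0 < s by rewrite !divr_gt0.
rewrite [in leRHS]/k !mulrDr mulr1.
have h1 := ler_wpM2r (normr_ge0 u) ts.
have h2 := ler_wpM2r (normr_ge0 v) rs.
lra.
Qed.

(** The second difference of f is symmetric in u and v. Divided by s^2, it is a value of each mixed
    derivative in an arbitrarily small box at x, and continuity concludes. *)
Lemma schwarz (f fu fv fuv fvu : 'rV[R]_6 -> R) x u v :
  (\forall y \near x, is_derive y u f (fu y)) ->
  (\forall y \near x, is_derive y v f (fv y)) ->
  (\forall y \near x, is_derive y v fu (fuv y)) ->
  (\forall y \near x, is_derive y u fv (fvu y)) ->
  {for x, continuous fuv} -> {for x, continuous fvu} -> fuv x = fvu x.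
Proof.
move=> du dv duv dvu cuv cvu; apply/eqP; rewrite -subr_eq0 -normr_le0.
apply/ler_addgt0Pr => e e0; rewrite add0r.
have e20 : 0 < e / 2 by lra.
have nA : \forall y \near x, `|fuv x - fuv y| < e / 2.
  by move/cvgrPdist_lt : cuv; exact.
have nB : \forall y \near x, `|fvu x - fvu y| < e / 2.
  by move/cvgrPdist_lt : cvu; exact.
have [s s0 box] := near_box _ x u v
  (filterI (filterI du duv) (filterI (filterI dv dvu) (filterI nA nB))).
have [t [r [tI rI E1]]] := second_difference f fu fuv x u v s s0
  (fun t r tI rI => (box t r tI rI).1.1)
  (fun t r tI rI => (box t r tI rI).1.2).
have sw t' r' : x + t' *: v + r' *: u = x + r' *: u + t' *: v by rewrite addrAC.
have [t' [r' [tI' rI' E2]]] : exists t r, [/\ 0 <= t <= s, 0 <= r <= s &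
    f (x + s *: v + s *: u) - f (x + s *: v) - (f (x + s *: u) - f x) =
    s * s * fvu (x + t *: v + r *: u)].
  apply: (second_difference f fv fvu x v u s s0) => t' r' tI' rI'; rewrite sw.
    exact: (box _ _ rI' tI').2.1.1.
  exact: (box _ _ rI' tI').2.1.2.
have [_ [_ [hA _]]] := box t r tI rI.
have [_ [_ [_ hB]]] := box r' t' rI' tI'.
rewrite -sw in hB.
have AB : fuv (x + t *: u + r *: v) = fvu (x + t' *: v + r' *: u).
  have ss : s * s != 0 by rewrite mulf_neq0 ?gt_eqF.
  apply: (mulfI ss); rewrite -E1 -E2 (sw s s).
  have comm (a b c d : R) : a - b - (c - d) = a - c - (b - d) by ring.
  exact: comm.
move: hA hB; rewrite AB; move: (fuv x) (fvu x) (fvu _) => a b c ac bc.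
rewrite -(subrKA c).
by apply: le_trans (ler_normD _ _) _; rewrite [in X in _ + X]distrC; lra.
Qed.
End Derivatives.

(** * Entrywise differentiation of matrix-valued maps *)

Section MatrixDerivatives.
Context {R : realType} {W : normedModType R}.
Implicit Types x v : W.

Lemma differentiable_mxP m n (f : W -> 'M[R]_(m, n)) x :
  differentiable f x <-> forall i k, differentiable (fun y => f y i k) x.
Proof.
split=> [df i k|df].
  have -> : (fun y => f y i k) = (fun A : 'M[R]_(m, n) => A i k : R) \o f by [].
  exact: differentiable_comp (differentiable_coord _ _ _).
have -> : f = \sum_(i < m) \sum_(k < n) (fun y => f y i k *: delta_mx i k).
  apply/funext => y; rewrite fct_sumE [LHS]matrix_sum_delta.
  by apply: eq_bigr => i _; rewrite fct_sumE.
apply: differentiable_sum => i; apply: differentiable_sum => k.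
exact: differentiableZl.
Qed.

Lemma is_derive_mxP m n (f : W -> 'M[R]_(m, n)) df x v :
  is_derive x v f df <-> forall i k, is_derive x v (fun y => f y i k) (df i k).
Proof.
split=> [[dfx <-] i k|h].
  apply: DeriveDef; first by move/derivable_mxP: dfx; apply.
  by rewrite derive_mx// mxE.
have dfx : derivable f x v by apply/derivable_mxP => i k; have [] := h i k.
apply: DeriveDef => //; rewrite derive_mx//; apply/matrixP => i k; rewrite mxE.
by have [] := h i k.
Qed.

Lemma is_derive_mulmx m n p (f : W -> 'M[R]_(m, n)) (g : W -> 'M[R]_(n, p))
    df dg x v : is_derive x v f df -> is_derive x v g dg ->
  is_derive x v (fun y => f y *m g y) (df *m g x + f x *m dg).
Proof.
move=> /is_derive_mxP hf /is_derive_mxP hg; apply/is_derive_mxP => i k.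
have -> : (fun y => (f y *m g y) i k)
    = \sum_l ((fun y => f y i l) * (fun y => g y l k)).
  by apply/funext => y; rewrite mxE fct_sumE.
have -> : (df *m g x + f x *m dg) i k
    = \sum_l (f x i l *: dg l k + g x l k *: df i l).
  rewrite !mxE -big_split; apply: eq_bigr => l _ /=.
  by rewrite addrC [df _ _ * _]mulrC.
by apply: is_derive_sum => l; exact: is_deriveM.
Qed.

End MatrixDerivatives.

(** * Regularity on an open set *)

Section SmoothFunctions.
Context {R : realType} (V : set 'rV[R]_6).
Implicit Types f h : 'rV[R]_6 -> R.

(* Unlike [of_Cn], this predicate depends only on the values taken on V. *)
Fixpoint scalar_Cn (n : nat) f : Prop :=
  match n with
  | 0 => forall x, V x -> {for x, continuous f}
  | m.+1 => exists g : 'rV[R]_6 -> 'rV[R]_6 -> R,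
      [/\ forall x, V x -> differentiable f x,
          forall x v, V x -> is_derive x v f (g v x)
        & forall v, scalar_Cn m (g v)]
  end.

Lemma scalar_CnW n f : scalar_Cn n.+1 f -> scalar_Cn n f.
Proof.
elim: n f => [|n ih] f [g [df dg Cg]].
  by move=> x Vx; apply: differentiable_continuous; exact: df.
by exists g; split=> // v; apply: ih.
Qed.

Lemma scalar_Cn_cst n (a : R) : scalar_Cn n (fun=> a).
Proof.
elim: n a => [|n ih] a; first by move=> x _; exact: cst_continuous.
exists (fun _ _ => 0); split=> [x _|x v _|v]; last exact: ih.
  exact: differentiable_cst.
exact: is_derive_cst.
Qed.

Lemma scalar_CnD n f h : scalar_Cn n f -> scalar_Cn n h ->
  scalar_Cn n (fun x => f x + h x).
Proof.
elim: n f h => [|n ih] f h.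
  by move=> cf ch x Vx; exact: (cvgD (cf x Vx) (ch x Vx)).
move=> [g [df dg Cg]] [k [dh dk Ck]].
exists (fun v x => g v x + k v x).
split=> [x Vx|x v Vx|v]; last exact: (ih _ _ (Cg v) (Ck v)).
  exact: differentiableD (df x Vx) (dh x Vx).
exact: is_deriveD (dg x v Vx) (dk x v Vx).
Qed.

Lemma scalar_CnM n f h : scalar_Cn n f -> scalar_Cn n h ->
  scalar_Cn n (fun x => f x * h x).
Proof.
elim: n f h => [|n ih] f h.
  by move=> cf ch x Vx; exact: (cvgM (cf x Vx) (ch x Vx)).
move=> Cf Ch; have Cf' := scalar_CnW _ _ Cf; have Ch' := scalar_CnW _ _ Ch.
move: Cf Ch => [g [df dg Cg]] [k [dh dk Ck]].
exists (fun v x => f x * k v x + h x * g v x).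
split=> [x Vx|x v Vx|v].
- exact: differentiableM (df x Vx) (dh x Vx).
- exact: is_deriveM (dg x v Vx) (dk x v Vx).
- exact: (scalar_CnD _ _ _ (ih _ _ Cf' (Ck v)) (ih _ _ Ch' (Cg v))).
Qed.

Lemma scalar_Cn_sum n (I : finType) (F : I -> 'rV[R]_6 -> R) :
  (forall i, scalar_Cn n (F i)) -> scalar_Cn n (fun x => \sum_i F i x).
Proof.
move=> CF; elim: (index_enum I) => [|i s ih].
  by under eq_fun do rewrite big_nil; exact: scalar_Cn_cst.
by under eq_fun do rewrite big_cons; exact: scalar_CnD.
Qed.

Definition matrix_Cn m p n (F : 'rV[R]_6 -> 'M[R]_(m, p)) :=
  forall i k, scalar_Cn n (fun x => F x i k).

Lemma matrix_Cn_mul m p q n (F : 'rV[R]_6 -> 'M[R]_(m, p))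
    (G : 'rV[R]_6 -> 'M[R]_(p, q)) :
  matrix_Cn _ _ n F -> matrix_Cn _ _ n G ->
  matrix_Cn _ _ n (fun x => F x *m G x).
Proof.
move=> CF CG i k; under eq_fun do rewrite mxE.
by apply: scalar_Cn_sum => l; exact: scalar_CnM.
Qed.

Lemma matrix_Cn_cst m p n (A : 'M[R]_(m, p)) : matrix_Cn _ _ n (fun=> A).
Proof. by move=> i k; exact: scalar_Cn_cst. Qed.

Lemma matrix_Cn_tr m p n (F : 'rV[R]_6 -> 'M[R]_(m, p)) :
  matrix_Cn _ _ n F -> matrix_Cn _ _ n (fun x => (F x)^T).
Proof. by move=> CF i k; under eq_fun do rewrite mxE; exact: CF. Qed.

Lemma matrix_Cn_cliff (C : clifford_module R) n (F : 'rV[R]_6 -> 'rV[R]_6) :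
  matrix_Cn _ _ n F -> matrix_Cn _ _ n (fun x => cliff C (F x)).
Proof.
move=> CF i k; under eq_fun do rewrite cliffE summxE.
apply: scalar_Cn_sum => a; under eq_fun do rewrite mxE.
by apply: scalar_CnM; [exact: CF|exact: scalar_Cn_cst].
Qed.

Lemma of_Cn_matrix m p n (F : 'rV[R]_6 -> 'M[R]_(m, p)) :
  of_Cn n V F -> matrix_Cn _ _ n F.
Proof.
elim: n F => [|n ih] F /= CF i k.
  move=> x Vx; apply: (@continuous_comp _ _ _ F (fun A : 'M[R]_(m, p) => A i k)).
    exact: CF.
  exact: coord_continuous.
case: CF => dF CF; exists (fun v x => 'D_v F x i k).
split=> [x Vx|x v Vx|v]; last exact: ih.
  by have /differentiable_mxP := dF x Vx; exact.
have : is_derive x v F ('D_v F x) by exact/derivableP/diff_derivable/dF.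
by move/is_derive_mxP; exact.
Qed.

Hypothesis V_open : open V.

Lemma near_open x (P : 'rV[R]_6 -> Prop) :
  V x -> (forall y, V y -> P y) -> \forall y \near x, P y.
Proof.
move=> Vx VP; have : \forall y \near x, V y by apply: open_nbhs_nbhs.
by apply: filterS.
Qed.

Lemma scalar_Cn_schwarz f x u v (fu fv : 'rV[R]_6 -> R) fuv fvu : V x ->
  scalar_Cn 2 f ->
  (forall y, V y -> is_derive y u f (fu y)) ->
  (forall y, V y -> is_derive y v f (fv y)) ->
  is_derive x v fu fuv -> is_derive x u fv fvu -> fuv = fvu.
Proof.
move=> Vx [g [df dg Cg]] du dv [_ <-] [_ <-].
have E w fw : (forall y, V y -> is_derive y w f (fw y)) ->
    \forall y \near x, fw y = g w y.
  move=> dw; apply: near_open => // y Vy.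
  by have [_ <-] := dw y Vy; have [_ <-] := dg y w Vy.
rewrite (near_eq_derive _ (E u fu du)) (near_eq_derive _ (E v fv dv)).
have [gu [_ dgu Cgu]] := Cg u; have [gv [_ dgv Cgv]] := Cg v.
have [_ ->] := dgu x v Vx; have [_ ->] := dgv x u Vx.
apply: (schwarz f (g u) (g v) (gu v) (gv u) x u v).
- by apply: near_open => // y Vy; exact: dg.
- by apply: near_open => // y Vy; exact: dg.
- by apply: near_open => // y Vy; exact: dgu.
- by apply: near_open => // y Vy; exact: dgv.
- exact: Cgu.
- exact: Cgv.
Qed.

End SmoothFunctions.

(** * The equation nabla_X psi = mu X psi in a chart *)

Section SpinorForms.
Context {R : realType} (C : clifford_module R).
Variable psi : 'cV[R]_8.
Implicit Types X Y Z W : 'rV[R]_6.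
Local Notation j := (volj C).
Local Notation cl := (cliff C).

(** If psi has square norm c, this is c times the Kähler form g(JX, Y); [form3] is, up to a constant
    factor, one of the two real components of the complex volume form. *)
Definition form2 X Y : R := ip (cl X *m (cl Y *m psi)) (j *m psi).
Definition form3 X Y Z : R := ip (cl X *m (cl Y *m (cl Z *m psi))) (j *m psi).
Definition form4 X Y Z W : R :=
  ip (cl X *m (cl Y *m (cl Z *m (cl W *m psi)))) (j *m psi).

Lemma cliff_swapl X Y (u : 'cV[R]_8) :
  cl X *m (cl Y *m u) = - (cl Y *m (cl X *m u)) - (2 * dot X Y) *: u.
Proof.
by rewrite mulmxA cliff_swap mulmxBl mulNmx mul_scalar_mx mulmxA.
Qed.

Lemma form2_swap X Y : form2 X Y = - form2 Y X.
Proof.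
by rewrite /form2 cliff_swapl ipDl !ipNl ipZl ip_phi_jphi mulr0 subr0.
Qed.

Lemma form3_swapl X Y Z : form3 X Y Z = - form3 Y X Z.
Proof.
by rewrite /form3 cliff_swapl ipDl !ipNl ipZl ip_cliff_jphi mulr0 subr0.
Qed.

Lemma form3_swapr X Y Z : form3 X Y Z = - form3 X Z Y.
Proof.
rewrite /form3 (cliff_swapl Y) mulmxBr mulmxN -scalemxAr ipDl !ipNl ipZl.
by rewrite ip_cliff_jphi mulr0 subr0.
Qed.

(** Moving W across three vectors reverses the sign, so that only the three contractions remain.
    They pair the metric with w, and the symmetry of the metric makes them vanish under alternation:
    hence dW = 0. *)
Lemma form4_rot X Y Z W : form4 X Y Z W + form4 W X Y Z
  = - 2 * (dot Z W * form2 X Y - dot Y W * form2 X Z + dot X W * form2 Y Z).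
Proof.
have s34 : form4 X Y Z W = - form4 X Y W Z - 2 * dot Z W * form2 X Y.
  rewrite /form4 (cliff_swapl Z) !mulmxBr !mulmxN -!scalemxAr.
  by rewrite ipDl !ipNl ipZl.
have s23 : form4 X Y W Z = - form4 X W Y Z - 2 * dot Y W * form2 X Z.
  rewrite /form4 (cliff_swapl Y W) mulmxBr mulmxN -scalemxAr.
  by rewrite ipDl !ipNl ipZl.
have s12 : form4 X W Y Z = - form4 W X Y Z - 2 * dot X W * form2 Y Z.
  by rewrite /form4 (cliff_swapl X W) ipDl !ipNl ipZl.
by rewrite s34 s23 s12; ring.
Qed.

Lemma ip_volj_cliff (u : 'cV[R]_8) W :
  ip u (j *m (cl W *m psi)) = ip (cl W *m u) (j *m psi).
Proof. by rewrite mulmxA volj_cliff mulNmx ipNr -mulmxA ip_cliff. Qed.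

Section Wedge.
Variables (c : R) (J : 'M[R]_6).
Hypotheses (psi_norm : ip psi psi = c) (c_gt0 : 0 < c)
  (J_psi : forall X, cl (X *m J) *m psi = j *m (cl X *m psi)).

Lemma ex_orth X Y : exists2 Z, Z != 0 & dot X Z = 0 /\ dot Y Z = 0.
Proof.
pose A : 'M[R]_(6, 1 + 1) := row_mx X^T Y^T.
have : kermx A != 0.
  rewrite -mxrank_eq0 mxrank_ker -lt0n subn_gt0.
  exact: leq_ltn_trans (rank_leq_col _) _.
case/rowV0Pn => Z /sub_kermxP ZA Z0; exists Z => //.
move: ZA; rewrite mul_mx_row => /eqP; rewrite row_mx_eq0 => /andP[/eqP ZX /eqP ZY].
by rewrite (dotC X) (dotC Y) /dot ZX ZY mxE.
Qed.

(* With s = m, t = J m and u orthogonal to m and J m, the hypothesis says that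
   the spinor t u psi is orthogonal to all the vectors w psi; it is also
   orthogonal to psi and j psi. *)
Lemma wedge_form3_eq0 (m : 'rV[R]_6) :
  (forall X Y Z W, dot X m * form3 Y Z W - dot Y m * form3 X Z W
     + dot Z m * form3 X Y W - dot W m * form3 X Y Z = 0) -> m = 0.
Proof.
move=> mw; apply/eqP; apply: contraT => m0.
have J_sq := Jphi_sq C _ _ psi_norm c_gt0 _ J_psi.
have J_tr := Jphi_tr C _ _ psi_norm c_gt0 _ J_psi.
have dotJ X Y : dot (X *m J) Y = - dot X (Y *m J).
  by rewrite -dot_mulmx J_tr mulmxN dotNr.
have mJm : dot (m *m J) m = 0 by have := dotJ m m; rewrite (dotC m); lra.
have mmpos := dot_gt0 _ m0.
have [u u0 [um uJm]] := ex_orth m (m *m J).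
have mJu : cl m *m (cl (m *m J) *m psi) = dot m m *: (j *m psi).
  rewrite J_psi mulmxA -[cl m *m j]opprK -volj_cliff mulNmx -mulmxA.
  rewrite (mulmxA (cl m)) cliff_sq mul_scalar_mx scaleNr mulmxN opprK.
  by rewrite scalemxAr.
(* This removes the term in which W is paired with m; the terms with (Jm, m) and (u, m) vanish by
   orthogonality. *)
have f0 : form3 m (m *m J) u = 0.
  rewrite form3_swapr form3_swapl opprK /form3 mJu -scalemxAr ipZl.
  by rewrite ip_cliff_phi mulr0.
have orth W : form3 (m *m J) u W = 0.
  have := mw m (m *m J) u W; rewrite mJm (dotC u) um f0 !mulr0 !mul0r subr0 addr0 subr0.
  by move/eqP; rewrite mulf_eq0 gt_eqF//= => /eqP.
pose z := cl (m *m J) *m (cl u *m psi).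
have z0 : z = 0.
  apply: (spinor_ext C _ _ psi_norm c_gt0) => [||X].
  - by rewrite ip_cliff (ip_cliff_cliff C _ _ psi_norm) dotC uJm mulr0 oppr0.
  - rewrite ip_cliff (cliff_jphi C _ _ J_psi) mulNmx ipNr opprK.
    rewrite (ip_cliff_cliff C _ _ psi_norm) -mulmxA J_sq mulmxN mulmx1.
    by rewrite dotNr dotC um oppr0 mulr0.
  - have := orth (X *m J); rewrite form3_swapr form3_swapl opprK /form3 ip_cliff.
    rewrite (cliff_jphi C _ _ J_psi) mulNmx ipNr opprK -/z -mulmxA J_sq.
    by rewrite mulmxN mulmx1 cliffN mulNmx ipNr => /eqP; rewrite oppr_eq0 => /eqP.
have : cl (m *m J) *m z = 0 by rewrite z0 mulmx0.
rewrite /z mulmxA cliff_sq mul_scalar_mx dotJ -mulmxA J_sq mulmxN mulmx1.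
rewrite dotNr opprK => /eqP; rewrite scaler_eq0 oppr_eq0 gt_eqF//= => /eqP clu0.
case/eqP: u0; apply: (cliff_phi_inj C _ _ psi_norm c_gt0).
by rewrite clu0 cliff0 mul0mx.
Qed.

(** If W vanished, the hypothesis of [wedge_form3_eq0] would hold for every m, in particular for a
    basis vector. *)
Lemma ex_form3_neq0 : exists X Y Z, form3 X Y Z != 0.
Proof.
apply/not_existsP => f0.
have f30 X Y Z : form3 X Y Z = 0.
  apply/eqP; apply: contrapT => /negP f; apply: (f0 X); exists Y, Z; exact: f.
have : (delta_mx 0 0 : 'rV[R]_6) = 0.
  by apply: wedge_form3_eq0 => X Y Z W; rewrite !f30 !mulr0 subrr addr0 subrr.
by move/matrixP/(_ 0 0)/eqP; rewrite !mxE !eqxx oner_eq0.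
Qed.
End Wedge.
End SpinorForms.

(** * The Levi-Civita and spin connections in a chart *)

Section LocalConnection.
Context {R : realType} (C : clifford_module R).
Variables (V : set 'rV[R]_6) (G F : 'rV[R]_6 -> 'M[R]_6).
Hypotheses (V_open : open V)
  (G_smooth : forall n, matrix_Cn V 6 6 n G)
  (F_smooth : forall n, matrix_Cn V 6 6 n F)
  (G_sym : forall x, V x -> (G x)^T = G x)
  (F_orth : forall x, V x -> F x *m G x *m (F x)^T = 1%:M).
Implicit Types x u v w : 'rV[R]_6.
Local Notation cl := (cliff C).

(* v *m coframe x are the components, in the frame F, of the tangent vector with
   coordinates v. *)
Definition coframe x : 'M[R]_6 := G x *m (F x)^T.
Local Notation E := coframe.

Lemma frame_coframe x : V x -> F x *m E x = 1%:M.
Proof. by move=> Vx; rewrite mulmxA F_orth. Qed.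

Lemma coframe_frame x : V x -> E x *m F x = 1%:M.
Proof. by move=> /frame_coframe /mulmx1C. Qed.

Lemma coframe_smooth n : matrix_Cn V 6 6 n E.
Proof. by apply: matrix_Cn_mul => //; exact: matrix_Cn_tr. Qed.

Lemma matrix_C1_differentiable m n (H : 'rV[R]_6 -> 'M[R]_(m, n)) x : V x ->
  matrix_Cn V m n 1 H -> differentiable H x.
Proof.
move=> Vx CH; apply/differentiable_mxP => i k.
by have [f [df _ _]] := CH i k; exact: df.
Qed.

Lemma matrix_C1_is_derive m n (H : 'rV[R]_6 -> 'M[R]_(m, n)) x v : V x ->
  matrix_Cn V m n 1 H -> is_derive x v H ('D_v H x).
Proof.
by move=> Vx CH; apply/derivableP/diff_derivable/matrix_C1_differentiable.
Qed.

Definition dmetric x (c p q : 'I_6) : R :=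
  'D_(delta_mx ord0 c : 'rV[R]_6) (fun y => G y p q) x.

Definition local_christoffel x (k a b : 'I_6) : R :=
  2^-1 * \sum_(l < 6) invmx (G x) k l *
    (dmetric x a b l + dmetric x b a l - dmetric x l a b).

(* nabla_v Y = D_v Y + Y *m christoffel_mx v x *)
Definition christoffel_mx v x : 'M[R]_6 :=
  \matrix_(b, k) \sum_(a < 6) local_christoffel x k a b * v ord0 a.
Local Notation N := christoffel_mx.

Lemma dmetric_sym x c p q : V x -> dmetric x c p q = dmetric x c q p.
Proof.
move=> Vx; apply: near_eq_derive; apply: (near_open V V_open) => // y Vy.
by rewrite -[in LHS]G_sym// mxE.
Qed.

Lemma local_christoffel_sym x k a b : V x ->
  local_christoffel x k a b = local_christoffel x k b a.
Proof.
move=> Vx; congr (_ * _); apply: eq_bigr => l _; congr (_ * _).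
by rewrite (dmetric_sym _ _ a b)// [dmetric x a b l + _]addrC.
Qed.

Lemma christoffel_mx_sym x v w : V x -> w *m N v x = v *m N w x.
Proof.
move=> Vx; apply/rowP => k; rewrite !mxE.
under eq_bigr do rewrite mxE mulr_sumr.
rewrite exchange_big; apply: eq_bigr => a _; rewrite mxE mulr_sumr.
apply: eq_bigr => b _; rewrite local_christoffel_sym//.
by rewrite mulrCA [w _ _ * _]mulrC mulrA mulrCA mulrA.
Qed.

Lemma metric_unit x : V x -> G x \in unitmx.
Proof.
move=> Vx; have /mulmx1_unit[_] := frame_coframe _ Vx.
by rewrite /E unitmx_mul => /andP[].
Qed.

(** Multiplying by G lowers the upper index: the inverse metric cancels and the Christoffel symbols
    of the first kind remain. *)
Lemma christoffel_metric x v p m : V x ->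
  (N v x *m G x) p m = \sum_(a < 6) v ord0 a *
    (2^-1 * (dmetric x a p m + dmetric x p a m - dmetric x m a p)).
Proof.
move=> Vx; have Gs k l : G x k l = G x l k by rewrite -[in LHS]G_sym// mxE.
rewrite mxE; under eq_bigr do rewrite mxE mulr_suml.
rewrite exchange_big; apply: eq_bigr => a _ /=.
under eq_bigr do rewrite mulrAC mulrC.
rewrite -mulr_sumr; congr (_ * _).
under eq_bigr do rewrite -mulrA.
rewrite -mulr_sumr; congr (_ * _).
under eq_bigr do rewrite mulr_suml.
rewrite exchange_big /= (bigD1 m)//= [X in _ + X]big1 ?addr0.
  under eq_bigr do rewrite mulrAC.
  rewrite -mulr_suml -[RHS]mul1r; congr (_ * _).
  transitivity ((G x *m invmx (G x)) m m); last first.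
    by rewrite mulmxV ?metric_unit// mxE eqxx.
  by rewrite mxE; apply: eq_bigr => k _; rewrite mulrC Gs.
move=> l lm; under eq_bigr do rewrite mulrAC.
rewrite -mulr_suml; apply/eqP; rewrite mulf_eq0; apply/orP; left; apply/eqP.
transitivity ((G x *m invmx (G x)) m l); last first.
  by rewrite mulmxV ?metric_unit// mxE eq_sym (negbTE lm).
by rewrite mxE; apply: eq_bigr => k _; rewrite mulrC Gs.
Qed.

(** That is, nabla g = 0: two symbols of the first kind with p and m exchanged add up to the partial
    derivative of the entry (p, m). *)
Lemma metric_compat x v : V x -> 'D_v G x = N v x *m G x + (N v x *m G x)^T.
Proof.
move=> Vx; have dG : differentiable G x by exact: matrix_C1_differentiable.
rewrite derive_mx; last exact: diff_derivable.
apply/matrixP => p m; rewrite mxE [RHS]mxE [in X in _ + X]mxE !christoffel_metric//.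
rewrite derive_linear; last by have /differentiable_mxP := dG; exact.
rewrite -big_split; apply: eq_bigr => a _ /=.
rewrite -[_ *: _]/(_ * _) -[X in _ * X]/(dmetric x a p m) -mulrDr; congr (_ * _).
by rewrite (dmetric_sym _ a m p)//; field.
Qed.

(* The matrix of the g(nabla_v e_a, e_b), for v in coordinates. *)
Definition connection_mx v x : 'M[R]_6 := ('D_v F x + F x *m N v x) *m E x.
Local Notation A := connection_mx.

Lemma is_derive_frame x v : V x -> is_derive x v F ('D_v F x).
Proof. by move=> Vx; exact: matrix_C1_is_derive. Qed.

Lemma is_derive_metric x v : V x -> is_derive x v G ('D_v G x).
Proof. by move=> Vx; exact: matrix_C1_is_derive. Qed.

Lemma is_derive_trmx m n (H : 'rV[R]_6 -> 'M[R]_(m, n)) dH x v :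
  is_derive x v H dH -> is_derive x v (fun y => (H y)^T) dH^T.
Proof.
move=> /is_derive_mxP dHx; apply/is_derive_mxP => i k.
by rewrite mxE; under eq_fun do rewrite mxE; exact: dHx.
Qed.

Lemma is_derive_near (W : normedModType R) (f h : 'rV[R]_6 -> W) df dh x v :
  V x -> (forall y, V y -> f y = h y) ->
  is_derive x v f df -> is_derive x v h dh -> df = dh.
Proof.
move=> Vx fh [_ <-] [_ <-]; apply: near_eq_derive.
exact: (near_open V V_open).
Qed.

(** Differentiate the orthonormality F G F^T = 1 and replace the derivative of G by means of nabla g
    = 0. *)
Lemma connection_mx_skew x v : V x -> (A v x)^T = - A v x.
Proof.
move=> Vx; have dF := is_derive_frame _ v Vx.
have dFGF := is_derive_mulmx _ _ _ _ _ _ _ _ _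
  (is_derive_mulmx _ _ _ _ _ _ _ _ _ dF (is_derive_metric _ v Vx))
  (is_derive_trmx _ _ _ _ _ _ dF).
have := is_derive_near _ _ _ _ _ _ _ Vx F_orth dFGF (is_derive_cst 1%:M x v).
rewrite /= metric_compat// => D0; apply/eqP; rewrite -addr_eq0 addrC -D0.
rewrite /A /E !mulmxDl !mulmxDr !mulmxDl !trmx_mul !linearD/= !trmx_mul trmxK G_sym//.
rewrite !mulmxA -!addrA; apply/eqP; congr (_ + (_ + _)); exact: addrC.
Qed.

(** The derivative of an inverse, obtained from F E = 1. *)
Lemma is_derive_coframe x v : V x ->
  is_derive x v E (- (E x *m 'D_v F x *m E x)).
Proof.
move=> Vx; have dF := is_derive_frame _ v Vx.
have dE : is_derive x v E ('D_v E x).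
  by apply: matrix_C1_is_derive => //; exact: coframe_smooth.
have := is_derive_near _ _ _ _ _ _ _ Vx frame_coframe
  (is_derive_mulmx _ _ _ _ _ _ _ _ _ dF dE) (is_derive_cst 1%:M x v).
rewrite /= => /eqP; rewrite addrC addr_eq0 => /eqP /(congr1 (mulmx (E x))).
rewrite mulmxA coframe_frame// mul1mx mulmxN mulmxA => dEE.
by rewrite -dEE.
Qed.

Lemma is_derive_cliff (H : 'rV[R]_6 -> 'rV[R]_6) dH x v :
  is_derive x v H dH -> is_derive x v (fun y => cl (H y)) (cl dH).
Proof.
move=> /is_derive_mxP dHx; apply/is_derive_mxP => i k.
have -> : (fun y => cl (H y) i k) = \sum_a (C a i k \*: (fun y => H y 0 a)).
  apply/funext => y; rewrite cliffE summxE fct_sumE; apply: eq_bigr => a _.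
  by rewrite mxE mulrC.
have -> : cl dH i k = \sum_a (C a i k *: dH 0 a).
  by rewrite cliffE summxE; apply: eq_bigr => a _; rewrite mxE mulrC.
by apply: is_derive_sum => a; exact: is_deriveZ.
Qed.

Definition gam v x : 'M[R]_8 := cl (v *m E x).
Definition spin v x : 'M[R]_8 := 4^-1 *: cliff2 C (A v x).

(* nabla_v psi = dpsi at x *)
Definition has_cov v x (psi : 'rV[R]_6 -> 'cV[R]_8) (dpsi : 'cV[R]_8) : Prop :=
  is_derive x v psi (dpsi - spin v x *m psi x).

(** The Leibniz rule for Clifford multiplication. The field w has constant coordinates, so its
    covariant derivative consists of the Christoffel term alone; by [cliff2_comm], the commutator
    with the spin connection accounts for the derivative of the coframe. *)
Lemma has_cov_gam v w x psi dpsi : V x -> has_cov v x psi dpsi ->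
  has_cov v x (fun y => gam w y *m psi y)
    (gam (w *m N v x) x *m psi x + gam w x *m dpsi).
Proof.
move=> Vx dp; have dE := is_derive_coframe _ v Vx.
have dwE : is_derive x v (fun y => w *m E y) (w *m (- (E x *m 'D_v F x *m E x))).
  have := is_derive_mulmx _ _ _ _ _ _ _ _ _ (is_derive_cst w x v) dE.
  by rewrite /= mul0mx add0r.
have := is_derive_mulmx _ _ _ _ _ _ _ _ _ (is_derive_cliff _ _ _ _ dwE) dp.
congr is_derive.
have := cliff2_comm C (A v x) (w *m E x) (connection_mx_skew _ v Vx).
have -> : w *m E x *m A v x = w *m (E x *m 'D_v F x *m E x) + w *m N v x *m E x.
  rewrite /A !mulmxA mulmxDr !mulmxDl !mulmxA.
  have EF : G x *m (F x)^T *m F x = 1%:M := coframe_frame _ Vx.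
  by rewrite -(mulmxA w (G x)) -(mulmxA w (G x *m _) (F x)) EF mulmx1.
rewrite cliffD => comm; rewrite mulmxN cliffN mulNmx mulmxBr.
have -> : cl (w *m (E x *m 'D_v F x *m E x))
    = 4^-1 *: (cliff2 C (A v x) *m cl (w *m E x)
        - cl (w *m E x) *m cliff2 C (A v x)) - gam (w *m N v x) x.
  by rewrite comm scalerA mulVf ?pnatr_eq0// scale1r addrK.
rewrite mulmxBl -scalemxAl mulmxBl scalerBr /spin -!scalemxAl -!scalemxAr !mulmxA.
rewrite !opprB.
have alg (a p q r : 'cV[R]_8) : a + (p - q) + (r - p) = a + r - q.
  by apply/matrixP => i k; rewrite !mxE; ring.
by rewrite alg /gam /E !mulmxA.
Qed.

(** j is parallel, because it commutes with quadratic Clifford elements. *)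
Lemma has_cov_volj v x psi dpsi : has_cov v x psi dpsi ->
  has_cov v x (fun y => volj C *m psi y) (volj C *m dpsi).
Proof.
move=> dp.
have := is_derive_mulmx _ _ _ _ _ _ _ _ _ (is_derive_cst (volj C) x v) dp.
rewrite /= mul0mx add0r mulmxBr.
by rewrite /has_cov /spin -!scalemxAl -scalemxAr !mulmxA cliff2_volj.
Qed.

(** The inner product of spinors is parallel, because the spin connection is skew. *)
Lemma is_derive_ip v x psi dpsi chi dchi : V x -> has_cov v x psi dpsi ->
  has_cov v x chi dchi ->
  is_derive x v (fun y => ip (psi y) (chi y)) (ip dpsi (chi x) + ip (psi x) dchi).
Proof.
move=> Vx dp dc.
have := is_derive_mulmx _ _ _ _ _ _ _ _ _ (is_derive_trmx _ _ _ _ _ _ dp) dc.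
move=> /is_derive_mxP/(_ ord0 ord0); congr is_derive.
rewrite mxE -!/(ip _ _) ipDl ipDr ipNl ipNr ip_mull.
have -> : (spin v x)^T = - spin v x.
  rewrite /spin linearZ/= cliff2_tr connection_mx_skew//.
  by rewrite linearN/= scalerN.
by rewrite mulNmx ipNr opprK addrACA addrN addr0.
Qed.

(** * The forms w and W of a solution, and the derivative of mu *)

Section Killing.
Variables (psi : 'rV[R]_6 -> 'cV[R]_8) (mu : 'rV[R]_6 -> R) (c : R)
  (J : 'rV[R]_6 -> 'M[R]_6).
Hypotheses (c_gt0 : 0 < c)
  (psi_smooth : forall n, matrix_Cn V 8 1 n psi)
  (psi_norm : forall x, V x -> ip (psi x) (psi x) = c)
  (J_psi : forall x X, V x ->
     cl (X *m J x) *m psi x = volj C *m (cl X *m psi x))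
  (killing : forall x v, V x ->
     has_cov v x psi (mu x *: (gam v x *m psi x))).

Definition lform2 u v x := form2 C (psi x) (u *m E x) (v *m E x).
Definition lform3 u v w x := form3 C (psi x) (u *m E x) (v *m E x) (w *m E x).

Lemma gam_smooth n v : matrix_Cn V 8 8 n (gam v).
Proof.
apply: matrix_Cn_cliff; apply: matrix_Cn_mul; first exact: matrix_Cn_cst.
exact: coframe_smooth.
Qed.

Lemma ip_smooth n p (f h : 'rV[R]_6 -> 'cV[R]_p) : matrix_Cn V p 1 n f ->
  matrix_Cn V p 1 n h -> scalar_Cn V n (fun x => ip (f x) (h x)).
Proof.
move=> Cf Ch; apply: (matrix_Cn_mul _ _ _ _ _ _ _ _ _ ord0 ord0) => //.
exact: matrix_Cn_tr.
Qed.

Lemma lform2_smooth n u v : scalar_Cn V n (lform2 u v).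
Proof.
apply: ip_smooth.
  by do ?[apply: matrix_Cn_mul; first exact: gam_smooth].
by apply: matrix_Cn_mul => //; exact: matrix_Cn_cst.
Qed.

Lemma lform3_smooth n u v w : scalar_Cn V n (lform3 u v w).
Proof.
apply: ip_smooth.
  by do ?[apply: matrix_Cn_mul; first exact: gam_smooth].
by apply: matrix_Cn_mul => //; exact: matrix_Cn_cst.
Qed.

(** The derivative of w along t: the Christoffel terms come from the coordinate fields u and v, and
    each of the two occurrences of psi yields mu W(t, u, v). *)
Definition dlform2 t u v x := lform2 (u *m N t x) v x + lform2 u (v *m N t x) x
  + 2 * mu x * lform3 t u v x.

Lemma is_derive_lform2 x t u v : V x -> is_derive x t (lform2 u v) (dlform2 t u v x).
Proof.
move=> Vx; have k := killing x t Vx.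
have := is_derive_ip _ _ _ _ _ _ Vx
  (has_cov_gam _ u _ _ _ Vx (has_cov_gam _ v _ _ _ Vx k)) (has_cov_volj _ _ _ _ k).
congr is_derive; rewrite /dlform2 /lform2 /lform3 /gam.
rewrite !mulmxDr -!scalemxAr !ipDl !ipZl !ipZr ip_volj_cliff.
rewrite -/(form2 C _ _ _) -/(form2 C _ _ _) -/(form3 C _ _ _ _) -/(form3 C _ _ _ _).
rewrite (form3_swapr C _ (u *m E x)) (form3_swapl C _ (u *m E x)); ring.
Qed.

(** The two occurrences of psi put t at the end and at the beginning of a product of four vectors;
    [form4_rot] reduces their sum to contractions. *)
Lemma is_derive_lform3 x t u v w : V x -> is_derive x t (lform3 u v w)
  (lform3 (u *m N t x) v w x + lform3 u (v *m N t x) w x + lform3 u v (w *m N t x) x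
   - 2 * mu x * (dot (w *m E x) (t *m E x) * lform2 u v x
     - dot (v *m E x) (t *m E x) * lform2 u w x
     + dot (u *m E x) (t *m E x) * lform2 v w x)).
Proof.
move=> Vx; have k := killing x t Vx.
have := is_derive_ip _ _ _ _ _ _ Vx (has_cov_gam _ u _ _ _ Vx
  (has_cov_gam _ v _ _ _ Vx (has_cov_gam _ w _ _ _ Vx k))) (has_cov_volj _ _ _ _ k).
congr is_derive; rewrite /lform3 /lform2 /gam.
have := form4_rot C (psi x) (u *m E x) (v *m E x) (w *m E x) (t *m E x).
rewrite !mulmxDr -!scalemxAr !ipDl !ipZl !ipZr ip_volj_cliff.
rewrite -!/(form3 C _ _ _ _) -!/(form4 C _ _ _ _ _).
by move=> /(canRL (addrK _)) ->; ring.
Qed.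

(* d w = 6 mu W *)
Lemma dlform2E x t u v : V x ->
  dlform2 t u v x - dlform2 u t v x + dlform2 v t u x = 6 * mu x * lform3 t u v x.
Proof.
(* The six Christoffel terms cancel in pairs, the connection being torsion-free and w skew; each of
   the three derivatives leaves 2 mu W. *)
move=> Vx; rewrite /dlform2 (christoffel_mx_sym x u t)// (christoffel_mx_sym x t v)//.
rewrite (christoffel_mx_sym x u v)// /lform2 /lform3.
rewrite (form2_swap C _ (t *m N v x *m E x)).
rewrite (form3_swapl C _ (u *m E x) (t *m E x)).
rewrite (form3_swapl C _ (v *m E x) (t *m E x)).
rewrite (form3_swapr C _ (t *m E x) (v *m E x) (u *m E x)).
ring.
Qed.

(** The formula for [dlform2] contains mu, whose differentiability is still to be shown. The
    regularity is taken instead from [lform2], which is smooth and has [dlform2] as its derivative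
    on V. *)
Lemma dlform2_C1 t u v : exists g, [/\ forall x, V x -> g x = dlform2 t u v x,
  forall x, V x -> differentiable g x
  & forall x s, V x -> is_derive x s (dlform2 t u v) ('D_s (dlform2 t u v) x)].
Proof.
have [g [_ dg Cg]] := lform2_smooth 2 u v.
have gE x : V x -> g t x = dlform2 t u v x.
  move=> Vx; have [_ <-] := dg x t Vx.
  by have [_ <-] := is_derive_lform2 x t u v Vx.
have [g' [d1 dg' _]] := Cg t.
exists (g t); split=> // x s Vx.
apply: derivableP; have [+ _] := dg' x s Vx.
by apply: near_eq_derivable; apply: (near_open V V_open).
Qed.

Lemma d2lform2_sym x s t u v : V x ->
  'D_s (dlform2 t u v) x = 'D_t (dlform2 s u v) x.
Proof.
move=> Vx; have [_ [_ _ dt]] := dlform2_C1 t u v.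
have [_ [_ _ ds]] := dlform2_C1 s u v.
apply: (scalar_Cn_schwarz V V_open (lform2 u v) x t s (dlform2 t u v)
  (dlform2 s u v)) => //.
- exact: lform2_smooth.
- by move=> y Vy; exact: is_derive_lform2.
- by move=> y Vy; exact: is_derive_lform2.
- exact: dt.
- exact: ds.
Qed.

Lemma ex_lform3_neq0 x : V x -> exists t u v, lform3 t u v x != 0.
Proof.
move=> Vx; have [X [Y [Z f]]] := ex_form3_neq0 C _ _ _ (psi_norm x Vx) c_gt0 (J_psi x ^~ Vx).
exists (X *m F x), (Y *m F x), (Z *m F x).
by rewrite /lform3 -!mulmxA frame_coframe// !mulmx1.
Qed.

(* By dlform2E, mu is a quotient of differentiable functions. *)
Lemma is_derive_mu x : V x -> exists m : 'rV[R]_6,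
  forall v, is_derive x v mu (dot (v *m E x) m).
Proof.
move=> Vx; have [t [u [v f0]]] := ex_lform3_neq0 x Vx.
have [g1 [g1E dg1 _]] := dlform2_C1 t u v.
have [g2 [g2E dg2 _]] := dlform2_C1 u t v.
have [g3 [g3E dg3 _]] := dlform2_C1 v t u.
have [g4 [dg4 _ _]] := lform3_smooth 1 t u v.
pose den : 'rV[R]_6 -> R := (6 : R) \*: lform3 t u v.
have dden : differentiable den x by apply: differentiableZ; exact: dg4.
have den0 : den x != 0 by rewrite mulf_neq0// pnatr_eq0.
pose h : 'rV[R]_6 -> R := (g1 - g2 + g3) * (fun y => (den y)^-1).
have dh : differentiable h x.
  apply: differentiableM; last exact: differentiableV.
  by apply: differentiableD; [apply: differentiableB|]; [exact: dg1|exact: dg2|exact: dg3].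
have hmu : \forall y \near x, h y = mu y.
  have nden : \forall y \near x, den y != 0.
    exact: (cvgr_neq0 _ (differentiable_continuous dden)).
  near=> y; have Vy : V y by near: y; exact: (near_open V V_open).
  have dy : den y != 0 by near: y.
  rewrite /h -[LHS]/((g1 y - g2 y + g3 y) / den y) g1E// g2E// g3E// dlform2E//.
  apply: (canLR (mulfK dy)); rewrite /den/= -[_ *: _]/(_ * _); ring.
(* The gradient of mu in frame components: F turns partial derivatives into derivatives along the
   frame, and E F = 1 undoes this when it is paired with v E. *)
exists ((\row_a 'D_(delta_mx 0 a) h x) *m (F x)^T) => v'.
apply: near_eq_is_derive hmu _.
have dhv := derivableP (diff_derivable (v := v') dh).
move: dhv; rewrite {1}derive_linear//; congr is_derive.
rewrite dot_mulmx -mulmxA coframe_frame// mulmx1 dotE.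
by apply: eq_bigr => a _; rewrite !mxE.
Unshelve. all: by end_near.
Qed.

Lemma killing_derive_eq0 x v : V x -> is_derive x v mu 0.
Proof.
move=> Vx; have [m dmu] := is_derive_mu x Vx.
suff m0 : m = 0 by have := dmu v; rewrite m0 /dot trmx0 mulmx0 mxE.
apply: (wedge_form3_eq0 C _ _ _ (psi_norm x Vx) c_gt0 (J_psi x ^~ Vx)).
suff w s t u w : dot (s *m E x) m * lform3 t u w x - dot (t *m E x) m * lform3 s u w x
     + dot (u *m E x) m * lform3 s t w x - dot (w *m E x) m * lform3 s t u x = 0.
  move=> X Y Z W; have := w (X *m F x) (Y *m F x) (Z *m F x) (W *m F x).
  by rewrite /lform3 -!mulmxA frame_coframe// !mulmx1.
(* The equation dw = 6 mu W differentiated along a, with [m] as the gradient of mu. *)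
have d2 a b d e : 'D_a (dlform2 b d e) x - 'D_a (dlform2 d b e) x
    + 'D_a (dlform2 e b d) x
  = 6 * (mu x * 'D_a (lform3 b d e) x + lform3 b d e x * dot (a *m E x) m).
  have [_ [_ _ d1]] := dlform2_C1 b d e.
  have [_ [_ _ d2]] := dlform2_C1 d b e.
  have [_ [_ _ d3]] := dlform2_C1 e b d.
  have d4 : is_derive x a (lform3 b d e) ('D_a (lform3 b d e) x).
    by have [_ ->] := is_derive_lform3 x a b d e Vx; exact: is_derive_lform3.
  have e1 := is_deriveD (is_deriveB (d1 x a Vx) (d2 x a Vx)) (d3 x a Vx).
  have e2 := is_deriveZ 6 (is_deriveM (dmu a) d4).
  apply: (is_derive_near _ _ _ _ _ _ _ Vx _ e1 e2) => y Vy.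
  rewrite -[LHS]/(dlform2 b d e y - dlform2 d b e y + dlform2 e b d y) dlform2E//.
  by rewrite -mulrA.
have d3 a b d e := @derive_val _ _ _ _ _ _ _ (is_derive_lform3 x a b d e Vx).
(* In the alternating sum of these identities the second derivatives of w cancel
   by d2lform2_sym, and the terms coming from dW cancel by symmetry. *)
have := d2 s t u w; have := d2 t s u w; have := d2 u s t w; have := d2 w s t u.
rewrite (d2lform2_sym x t s)// (d2lform2_sym x u s)// (d2lform2_sym x w s)//.
rewrite (d2lform2_sym x u t)// (d2lform2_sym x w t)// (d2lform2_sym x w u)//.
rewrite !d3.
rewrite (christoffel_mx_sym x t s)// (christoffel_mx_sym x u s)//.
rewrite (christoffel_mx_sym x w s)// (christoffel_mx_sym x u t)//.
rewrite (christoffel_mx_sym x w t)// (christoffel_mx_sym x w u)//.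
have front2 a b d : lform3 a b d x = - lform3 b a d x by exact: form3_swapl.
have front3 a b d : lform3 a b d x = lform3 d a b x.
  by rewrite /lform3 form3_swapr form3_swapl opprK.
(* The vector that carries the Christoffel matrix is brought to the first place, so that equal terms
   become identical; after abstraction the identity is linear in the remaining monomials. *)
rewrite !(front2 _ (_ *m N _ _)) !(front3 _ _ (_ *m N _ _)).
rewrite (dotC (t *m E x) (s *m E x)) (dotC (u *m E x) (s *m E x)).
rewrite (dotC (w *m E x) (s *m E x)) (dotC (u *m E x) (t *m E x)).
rewrite (dotC (w *m E x) (t *m E x)) (dotC (w *m E x) (u *m E x)).
repeat match goal with |- context [lform3 ?a ?b ?d x] => move: (lform3 a b d x) => ? end.
repeat match goal with |- context [lform2 ?a ?b x] => move: (lform2 a b x) => ? end.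
repeat match goal with |- context [dot ?a ?b] => move: (dot a b) => ? end.
repeat match goal with |- context ['D_ ?a ?b x] => move: ('D_ a b x) => ? end.
move: (mu x) => ?.
lra.
Qed.

End Killing.
End LocalConnection.

(** * Change of charts *)

Section Pullback.
Context {R : realType}.
Variables (U : set 'rV[R]_6) (T : 'rV[R]_6 -> 'rV[R]_6).
Hypotheses (U_open : open U) (T_smooth : smooth_on U T).
Implicit Types x u v w : 'rV[R]_6.

Lemma pullback_differentiable x : U x -> differentiable T x.
Proof. by move=> Ux; have [h _] := T_smooth 1; exact: h. Qed.

Lemma is_derive_pullback x u v : U x ->
  is_derive x v (fun y => 'D_u T y) ('D_v (fun y => 'D_u T y) x).
Proof.
move=> Ux; apply/derivableP/diff_derivable.
by have [_ /(_ u) [h _]] := T_smooth 2; exact: h.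
Qed.

Lemma pullback_sym x u v : U x ->
  'D_v (fun y => 'D_u T y) x = 'D_u (fun y => 'D_v T y) x.
Proof.
move=> Ux; apply/rowP => k.
have dT w y : U y -> is_derive y w (fun y => T y 0 k) ('D_w T y 0 k).
  move=> Uy; have : is_derive y w T ('D_w T y).
    exact/derivableP/diff_derivable/pullback_differentiable.
  by move/is_derive_mxP; exact.
have ddT w w' : is_derive x w' (fun y => 'D_w T y 0 k)
    ('D_w' (fun y => 'D_w T y) x 0 k).
  by have /is_derive_mxP := is_derive_pullback x w w' Ux; exact.
apply: (scalar_Cn_schwarz U U_open (fun y => T y 0 k) x u v
  (fun y => 'D_u T y 0 k) (fun y => 'D_v T y 0 k)) => //.
exact: (of_Cn_matrix U _ _ 2 T (T_smooth 2)).
Qed.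

(* Naturality of the exterior derivative of the 2-form with matrix W. *)
Lemma pullback_exterior (W : 'rV[R]_6 -> 'M[R]_6) (dW : 'rV[R]_6 -> 'M[R]_6)
    (dom : 'rV[R]_6 -> 'rV[R]_6 -> 'rV[R]_6 -> R)
    (om : 'rV[R]_6 -> 'rV[R]_6 -> 'rV[R]_6 -> R) x u v w (a b d : R) : U x ->
  differentiable W (T x) -> (forall p, is_derive (T x) p W (dW p)) ->
  (forall p q : 'rV[R]_6, (p *m W (T x) *m q^T) 0 0 = - (q *m W (T x) *m p^T) 0 0) ->
  (forall p q y, U y -> om p q y = ('D_p T y *m W (T y) *m ('D_q T y)^T) 0 0) ->
  (forall p q r : 'rV[R]_6, dom p q r = (q *m dW p *m r^T) 0 0) ->
  is_derive x u (om v w) a -> is_derive x v (om u w) b ->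
  is_derive x w (om u v) d ->
  a - b + d = dom ('D_u T x) ('D_v T x) ('D_w T x)
            - dom ('D_v T x) ('D_u T x) ('D_w T x)
            + dom ('D_w T x) ('D_u T x) ('D_v T x).
Proof.
move=> Ux dfW dWP Wskew omE domE da db dd; rewrite !domE.
have dT := pullback_differentiable _ Ux.
have dWT p : is_derive x p (W \o T) (dW ('D_p T x)).
  apply/is_derive_mxP => i k.
  have dfWik : differentiable (fun y => W y i k) (T x).
    by have /differentiable_mxP := dfW; exact.
  have := derive_chain (fun y => W y i k) T x p dT dfWik.
  have /is_derive_mxP/(_ i k)[_ ->] := dWP ('D_p T x).
  exact.
(* [P] is the second derivative of the transition map. Its contributions cancel in the alternating
   sum, since [P] is symmetric and W skew. *)
have [P Psym dP] : exists2 P : 'rV[R]_6 -> 'rV[R]_6 -> 'rV[R]_6,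
    (forall p q, P p q = P q p)
    & forall p q, is_derive x p (fun y => 'D_q T y) (P p q).
  exists (fun p q => 'D_p (fun y => 'D_q T y) x) => p q.
    exact: pullback_sym.
  exact: is_derive_pullback.
have H p q r t : is_derive x p (om q r) t ->
    t = (P p q *m W (T x) *m ('D_r T x)^T) 0 0
      + ('D_q T x *m dW ('D_p T x) *m ('D_r T x)^T) 0 0
      + ('D_q T x *m W (T x) *m (P p r)^T) 0 0.
  move=> dt.
  have := is_derive_mulmx _ _ _ _ _ _ _ _ _ (is_derive_mulmx _ _ _ _ _ _ _ _ _
    (dP p q) (dWT p)) (is_derive_trmx _ _ _ _ _ _ (dP p r)).
  move/is_derive_mxP/(_ 0 0) => dt'.
  have -> := is_derive_near U U_open _ _ _ _ _ _ _ Ux (omE q r) dt dt'.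
  by rewrite mulmxDl [LHS]mxE [in LHS]mxE.
rewrite (H _ _ _ _ da) (H _ _ _ _ db) (H _ _ _ _ dd).
move: ('D_u T x) ('D_v T x) ('D_w T x) => tu tv tw.
rewrite (Psym v u) (Psym w u) (Psym w v) (Wskew tv).
have alg (p q r s e f : R) : p + q - r - (p + s + f) + (r + e + f) = q - s + e by ring.
exact: alg.
Qed.
End Pullback.

(** A ball contains the segment from its centre to any of its points, and the mean value theorem
    applies along it. *)
Lemma locally_constant (R : realType) (V : set 'rV[R]_6) (f : 'rV[R]_6 -> R) x :
  open V -> (forall y v, V y -> is_derive y v f 0) -> V x ->
  \forall y \near x, f y = f x.
Proof.
move=> V_open df Vx.
have /nbhs_ballP[d /= d0 dV] : \forall y \near x, V y by apply: open_nbhs_nbhs.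
apply/nbhs_ballP; exists d => //= y xy.
pose h (t : R) := f (x + t *: (y - x)).
have hd (t : R) : 0 <= t <= 1 -> is_derive t (1 : R) h 0.
  move=> /andP[t0 t1]; apply: is_derive_along; apply: df; apply: dV.
  rewrite -ball_normE /= opprD addrA subrr add0r normrN normrZ ger0_norm//.
  rewrite distrC; apply: le_lt_trans (_ : `|x - y| < d).
    by rewrite ler_piMl.
  by move: xy; rewrite -ball_normE.
have hd' (t : R) : t \in `]0, 1[ -> is_derive t (1 : R) h ((fun=> 0 : R) t).
  by rewrite in_itv/= => /andP[t0 t1]; apply: hd; rewrite !ltW.
have hc : {within `[(0 : R), 1], continuous h}.
  apply: derivable_within_continuous => t; rewrite in_itv/= => ts.
  by have [] := hd t ts.
have [t _] := MVT ltr01 hd' hc.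
rewrite mul0r /h scale1r scale0r addr0 [x + _]addrC subrK => /eqP.
by rewrite subr_eq0 => /eqP.
Qed.

Section SpinGroup.
Context {R : realType} (C : clifford_module R).

(** j anticommutes with each of an even number of vectors. *)
Lemma spin_group_volj (s : 'M[R]_8) : spin_group C s ->
  s *m volj C = volj C *m s.
Proof.
case=> vs [even _ ->].
have -> : volj C *m \prod_(v <- vs) cliff C v
    = (-1) ^+ size vs *: (\prod_(v <- vs) cliff C v *m volj C).
  elim: vs {even} => [|v vs ih].
    by rewrite !big_nil scale1r mulmx1 mul1mx.
  rewrite !big_cons mulmxA volj_cliff mulNmx -mulmxA ih -scalemxAr mulmxA.
  by rewrite exprS mulN1r scaleNr.
by rewrite -signr_odd (negbTE even) scale1r.
Qed.

Lemma spin_group_orth (s : 'M[R]_8) : spin_group C s -> s^T *m s = 1%:M.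
Proof.
case=> vs [_ unit ->]; elim: vs unit => [|v vs ih] unit.
  by rewrite !big_nil trmx1 mul1mx.
rewrite !big_cons trmx_mul mulmxA -(mulmxA _ (cliff C v)^T) cliff_tr mulNmx.
rewrite cliff_sq -raddfN/= opprK.
have -> : dot v v = 1 by rewrite -[RHS](unit v) ?mem_head// /ip trmxK.
rewrite mulmx1; apply: ih => w wvs; apply: unit; by rewrite in_cons wvs orbT.
Qed.

Lemma spin_group_ip (s : 'M[R]_8) u v : spin_group C s ->
  ip (s *m u) (s *m v) = ip u v.
Proof. by move=> /spin_group_orth ss; rewrite ip_mull mulmxA ss mul1mx. Qed.

End SpinGroup.

(** * Independence of mu from the chart and constancy on M *)

Section Naturality.
Context {R : realType} {C : clifford_module R} {M : topologicalType}
  {At : oriented_atlas R M} {g : riemannian_metric At}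
  {P : spin_structure g C}.
Variables (psi : idx At -> 'rV[R]_6 -> 'cV[R]_8)
  (mu : idx At -> 'rV[R]_6 -> R) (c : R) (J : idx At -> 'rV[R]_6 -> 'M[R]_6).
Hypotheses (c_gt0 : 0 < c)
  (psi_smooth : forall i n, matrix_Cn (img i) 8 1 n (psi i))
  (psi_trans : forall i k x, overlap i k x ->
     psi i x = Defs.lift P i k x *m psi k (trans i k x))
  (psi_norm : forall i x, img i x -> ip (psi i x) (psi i x) = c)
  (J_psi : forall i x X, img i x ->
     cliff C (X *m J i x) *m psi i x = volj C *m (cliff C X *m psi i x))
  (killing : forall i x v, img i x -> has_cov C (g i) (frame P i) v x (psi i)
     (mu i x *: (gam C (g i) (frame P i) v x *m psi i x))).
Implicit Types (i k : idx At) (x u v w : 'rV[R]_6).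

Lemma metric_Cn i n : matrix_Cn (img i) 6 6 n (g i).
Proof. by apply: of_Cn_matrix; exact: metric_smooth. Qed.

Lemma frame_Cn i n : matrix_Cn (img i) 6 6 n (frame P i).
Proof. by apply: of_Cn_matrix; exact: frame_smooth. Qed.

Local Notation om i := (lform2 C (g i) (frame P i) (psi i)).
Local Notation dom2 i := (dlform2 C (g i) (frame P i) (psi i) (mu i)).
Local Notation om3 i := (lform3 C (g i) (frame P i) (psi i)).
Local Notation E i := (coframe (g i) (frame P i)).

Lemma is_derive_om i x t u v : img i x ->
  is_derive x t (om i u v) (dom2 i t u v x).
Proof.
exact: (is_derive_lform2 C (img i) (g i) (frame P i) (@img_open _ _ At i) (metric_Cn i)
  (frame_Cn i) (@Defs.metric_sym _ _ _ g i) (@frame_orthonormal _ _ _ _ _ P i)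
  (psi i) (mu i) (killing i) x t u v).
Qed.

Lemma overlap_open i k : open (@overlap R M At i k).
Proof.
rewrite openE => x [xi xk]; rewrite /interior.
apply: filterI; first by apply: open_nbhs_nbhs; split=> //; exact: img_open.
by apply: (param_continuous xi); apply: open_nbhs_nbhs; split=> //; exact: dom_open.
Qed.

Lemma trans_img i k x : overlap i k x -> img k (trans i k x).
Proof. by case=> xi xk; exact: chart_img. Qed.

(** For vectors given in coordinates, the change of frame covered by the lift is the differential of
    the transition map. *)
Lemma gam_lift i k x v : overlap i k x ->
  gam C (g i) (frame P i) v x *m Defs.lift P i k x
  = Defs.lift P i k x *m gam C (g k) (frame P k) ('D_v (trans i k) x) (trans i k x).
Proof.
move=> ov; have yk := trans_img _ _ _ ov; have [xi _] := ov.
have FEi := coframe_frame (img i) (g i) (frame P i) (@frame_orthonormal _ _ _ _ _ P i) x xi.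
have FEk := frame_coframe (img k) (g k) (frame P k) (@frame_orthonormal _ _ _ _ _ P k) _ yk.
rewrite /gam lift_frame//; congr (_ *m cliff C _).
rewrite -(mulmxA v) FEi mulmx1 deriveEjacobian; last first.
  exact: (pullback_differentiable (overlap i k) _ (@trans_smooth _ _ At i k)).
congr (_ *m _).
have [Fu _] := mulmx1_unit FEk.
by rewrite -[LHS]mulmx1 -FEk mulmxA mulVmx// mul1mx.
Qed.

(** The lift is moved to the left across the vectors; it commutes with j and then disappears as an
    isometry. The same argument serves for W. *)
Lemma om_trans i k u v x : overlap i k x ->
  om i u v x = om k ('D_u (trans i k) x) ('D_v (trans i k) x) (trans i k x).
Proof.
move=> ov; rewrite /lform2 /form2.
have gl := gam_lift i k x; rewrite /gam in gl.
rewrite (psi_trans _ _ _ ov) (mulmxA _ (Defs.lift _ _ _ _)) gl// -mulmxA.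
rewrite (mulmxA _ (Defs.lift _ _ _ _)) gl// -mulmxA (mulmxA (volj C)).
have sp := lift_spin P ov.
by rewrite -(spin_group_volj C _ sp) -mulmxA (spin_group_ip C _ _ _ sp).
Qed.

Lemma om3_trans i k u v w x : overlap i k x ->
  om3 i u v w x = om3 k ('D_u (trans i k) x) ('D_v (trans i k) x)
    ('D_w (trans i k) x) (trans i k x).
Proof.
move=> ov; rewrite /lform3 /form3.
have gl := gam_lift i k x; rewrite /gam in gl.
rewrite (psi_trans _ _ _ ov) (mulmxA _ (Defs.lift _ _ _ _)) gl// -mulmxA.
rewrite (mulmxA _ (Defs.lift _ _ _ _)) gl// -mulmxA.
rewrite (mulmxA _ (Defs.lift _ _ _ _)) gl// -mulmxA (mulmxA (volj C)).
have sp := lift_spin P ov.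
by rewrite -(spin_group_volj C _ sp) -mulmxA (spin_group_ip C _ _ _ sp).
Qed.

Lemma om_mx i u v x : om i u v x
  = (u *m (\matrix_(a, b) om i (delta_mx 0 a) (delta_mx 0 b) x) *m v^T) 0 0.
Proof.
have sumE (p : 'rV[R]_6) : p *m E i x = \sum_a p 0 a *: (delta_mx 0 a *m E i x).
  by rewrite {1}[p]row_sum_delta mulmx_suml; apply: eq_bigr => a _; rewrite scalemxAl.
rewrite mxE; under eq_bigr do rewrite mxE mulr_suml.
rewrite exchange_big /=.
transitivity (\sum_a u 0 a * om i (delta_mx 0 a) v x).
  rewrite /lform2 /form2 [in LHS]sumE cliff_sum (mulmx_suml _ _ _ (fun a => cliff C _)).
  rewrite ip_suml.
  by apply: eq_bigr => a _; rewrite cliffZ -scalemxAl ipZl.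
apply: eq_bigr => a _.
transitivity (u 0 a * \sum_b v 0 b * om i (delta_mx 0 a) (delta_mx 0 b) x).
  congr (_ * _); rewrite /lform2 /form2 (sumE v) cliff_sum.
  rewrite (mulmx_suml _ _ _ (fun a => cliff C _)) mulmx_sumr ip_suml.
  by apply: eq_bigr => b _; rewrite cliffZ -scalemxAl -scalemxAr ipZl.
rewrite mulr_sumr; apply: eq_bigr => b _; rewrite !mxE.
by rewrite [v _ _ * _]mulrC mulrA.
Qed.

Lemma om_Cn i n u v : scalar_Cn (img i) n (om i u v).
Proof.
exact: (lform2_smooth C (img i) (g i) (frame P i) (metric_Cn i) (frame_Cn i)
  (psi i) (psi_smooth i)).
Qed.

Lemma is_derive_om_mx i x t : img i x ->
  is_derive x t (fun y => \matrix_(a, b) om i (delta_mx 0 a) (delta_mx 0 b) y)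
    (\matrix_(a, b) dom2 i t (delta_mx 0 a) (delta_mx 0 b) x).
Proof.
move=> xi; apply/is_derive_mxP => a b; rewrite mxE.
have -> : (fun y => (\matrix_(a, b) om i (delta_mx 0 a) (delta_mx 0 b) y) a b)
    = om i (delta_mx 0 a) (delta_mx 0 b) by apply/funext => y; rewrite mxE.
exact: is_derive_om.
Qed.

(** Bilinearity of the derivative is inherited from that of w, by differentiating [om_mx]. *)
Lemma dom2_mx i t u v x : img i x -> dom2 i t u v x
  = (u *m (\matrix_(a, b) dom2 i t (delta_mx 0 a) (delta_mx 0 b) x) *m v^T) 0 0.
Proof.
move=> xi.
have d1 := is_derive_mulmx _ _ _ _ _ _ _ _ _ (is_derive_mulmx _ _ _ _ _ _ _ _ _
  (is_derive_cst u x t) (is_derive_om_mx i x t xi)) (is_derive_cst v^T x t).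
move/is_derive_mxP/(_ 0 0): d1 => d1.
have -> := is_derive_near (img i) (@img_open _ _ At i) _ _ _ _ _ _ _ xi
  (fun y _ => om_mx i u v y) (is_derive_om i x t u v xi) d1.
by rewrite mul0mx add0r mulmx0 addr0.
Qed.

(* Both charts compute d w = 6 mu W, and W does not vanish. *)
Lemma mu_trans i k x : overlap i k x -> mu i x = mu k (trans i k x).
Proof.
move=> ov; have yk := trans_img _ _ _ ov; have [xi _] := ov.
have [u [v [w f0]]] := ex_lform3_neq0 C (img i) (g i) (frame P i)
  (@frame_orthonormal _ _ _ _ _ P i) (psi i) c (J i) c_gt0 (psi_norm i)
  (J_psi i) x xi.
pose W y := (\matrix_(a, b) om k (delta_mx 0 a) (delta_mx 0 b) y : 'M[R]_6).
have [dW dWP dWE] : exists2 dW : 'rV[R]_6 -> 'M[R]_6,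
    forall p, is_derive (trans i k x) p W (dW p)
    & forall p a b, dom2 k p a b (trans i k x) = (a *m dW p *m b^T) 0 0.
  exists (fun p => \matrix_(a, b) dom2 k p (delta_mx 0 a) (delta_mx 0 b)
     (trans i k x)) => [p|p a b]; first exact: is_derive_om_mx.
  exact: dom2_mx.
have dfW : differentiable W (trans i k x).
  apply: (matrix_C1_differentiable (img k)) => // a b.
  have -> : (fun y => W y a b) = om k (delta_mx 0 a) (delta_mx 0 b).
    by apply/funext => y; rewrite mxE.
  exact: om_Cn.
have Wskew (p q : 'rV[R]_6) : (p *m W (trans i k x) *m q^T) 0 0
    = - (q *m W (trans i k x) *m p^T) 0 0.
  by rewrite -!om_mx; exact: form2_swap.
have omE p q y : overlap i k y -> om i p q y = ('D_p (trans i k) y *m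
    W (trans i k y) *m ('D_q (trans i k) y)^T) 0 0.
  by move=> ov'; rewrite (om_trans i k)// om_mx.
have := pullback_exterior (overlap i k) (trans i k) (overlap_open i k)
  (@trans_smooth _ _ At i k) W dW (fun p q r => dom2 k p q r (trans i k x)) (om i)
  x u v w _ _ _ ov dfW dWP Wskew omE dWE
  (is_derive_om i x u v w xi) (is_derive_om i x v u w xi) (is_derive_om i x w u v xi).
have dE l y p q r (yl : img l y) := dlform2E C (img l) (g l) (frame P l)
  (@img_open _ _ At l) (@Defs.metric_sym _ _ _ g l) (psi l) (mu l) y p q r yl.
rewrite (dE i)// (dE k)// -(om3_trans i k)// => /(mulIf f0).
by move/(mulfI (_ : 6 != 0)); apply; rewrite pnatr_eq0.
Qed.

(** By [mu_trans] the local functions define one function on M. The set where it takes its value at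
    a given point is open and closed, by local constancy in the charts. *)
Lemma mu_constant : connected [set: M] ->
  exists r, forall i x, img i x -> mu i x = r.
Proof.
move=> conn.
have dmu i x v : img i x -> is_derive x v (mu i) 0.
  exact: (killing_derive_eq0 C (img i) (g i) (frame P i) (@img_open _ _ At i)
    (metric_Cn i) (frame_Cn i) (@Defs.metric_sym _ _ _ g i)
    (@frame_orthonormal _ _ _ _ _ P i) (psi i) (mu i) c (J i) c_gt0
    (psi_smooth i) (psi_norm i) (J_psi i) (killing i)).
(* On the empty manifold any constant will do; 0 is taken. *)
have [[p0 _]|M0] := pselect (exists p : M, True); last first.
  by exists 0 => i x xi; case: M0; exists (param i x).
have [i0 p0i0] := dom_cover At p0.
pose r := mu i0 (chart i0 p0).
pose B := [set p : M | forall i, dom i p -> mu i (chart i p) = r].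
have muE i k p : dom i p -> dom k p -> mu i (chart i p) = mu k (chart k p).
  move=> pi pk; have ov : overlap i k (chart i p).
    by split; [exact: chart_img|rewrite chartK].
  by rewrite (mu_trans _ _ _ ov) /trans /= chartK.
have near_chart i p : dom i p ->
    \forall q \near p, dom i q /\ mu i (chart i q) = mu i (chart i p).
  move=> pi; apply: filterI.
    by apply: open_nbhs_nbhs; split=> //; exact: dom_open.
  apply: (@chart_continuous _ _ At i p pi [set y | mu i y = mu i (chart i p)]).
  apply: (locally_constant _ (img i)) => //; first exact: img_open.
  exact: chart_img.
have Bopen : open B.
  rewrite openE => p Bp; rewrite /interior; have [i pi] := dom_cover At p.
  apply: filterS (near_chart i p pi) => q [qi muq] k qk.
  by rewrite (muE k i)// muq; exact: Bp.
have Bclosed : closed B.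
  move=> p clB k pk; have [q [Bq [qk muq]]] := clB _ (near_chart k p pk).
  by rewrite -muq; exact: Bq.
have BT : B = [set: M].
  apply: conn; first by exists p0 => k pk; exact: muE.
    by exists B => //; rewrite setTI.
  by exists B => //; rewrite setTI.
exists r => i x xi.
have : B (param i x) by rewrite BT.
by move/(_ i (param_dom xi)); rewrite paramK.
Qed.

End Naturality.

(** * The covariant derivative of a spinor field, and the constancy of lambda and mu *)

Section SpinorDerivative.
Context {R : realType} {C : clifford_module R} {M : topologicalType}
  {At : oriented_atlas R M} {g : riemannian_metric At}
  {P : spin_structure g C}.
Variable phi : spinor_field P.
Implicit Types (i k : idx At) (x u v w X Y : 'rV[R]_6).
Local Notation E i := (coframe (g i) (frame P i)).

Lemma derive_linearP (W : normedModType R) (f : 'rV[R]_6 -> W) x (k : R) u v :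
  differentiable f x -> 'D_(k *: u + v) f x = k *: 'D_u f x + 'D_v f x.
Proof. by move=> df; rewrite !deriveE// linearP. Qed.

Lemma christoffel_mx_linearP (G : 'rV[R]_6 -> 'M[R]_6) x (k : R) u v :
  christoffel_mx G (k *: u + v) x = k *: christoffel_mx G u x + christoffel_mx G v x.
Proof.
apply/matrixP => b l; rewrite !mxE mulr_sumr -big_split.
by apply: eq_bigr => a _ /=; rewrite !mxE mulrDr mulrCA.
Qed.

Lemma levi_civitaE i x v (Z : 'rV[R]_6 -> 'rV[R]_6) :
  levi_civita g i x v Z = 'D_v Z x + Z x *m christoffel_mx (g i) v x.
Proof.
congr (_ + _); apply/rowP => l; rewrite !mxE exchange_big /=.
apply: eq_bigr => b _; rewrite mxE mulr_sumr; apply: eq_bigr => a _.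
by rewrite mulrC.
Qed.

Lemma connection_formE i x X a b : img i x ->
  connection_form P i x X a b
  = connection_mx (g i) (frame P i) (X *m frame P i x) x a b.
Proof.
move=> xi; rewrite /connection_form levi_civitaE.
have dF := matrix_C1_is_derive (img i) _ _ (frame P i) x (X *m frame P i x) xi (frame_Cn i 1).
have -> : 'D_(X *m frame P i x) (fun y => row a (frame P i y)) x
    = row a ('D_(X *m frame P i x) (frame P i) x).
  have : is_derive x (X *m frame P i x) (fun y => row a (frame P i y))
      (row a ('D_(X *m frame P i x) (frame P i) x)).
    move/is_derive_mxP: dF => dF; apply/is_derive_mxP => o l; rewrite mxE.
    by under eq_fun do rewrite mxE; exact: dF.
  by case.
rewrite -row_mul -linearD/= -mulmxA -row_mul /connection_mx /coframe.
rewrite [RHS]mxE [LHS]mxE [LHS]mxE; apply: eq_bigr => l _; congr (_ * _).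
by rewrite [LHS]mxE [RHS]mxE; apply: eq_bigr => m _; rewrite !mxE.
Qed.

Lemma nablaE i x X : img i x -> nabla phi i x X =
  'D_(X *m frame P i x) (phi i) x
  + spin C (g i) (frame P i) (X *m frame P i x) x *m phi i x.
Proof.
move=> xi; congr (_ + _); rewrite /spin -scalemxAl; congr (_ *: _).
rewrite cliff2E mulmx_suml; apply: eq_bigr => a _.
rewrite mulmx_suml; apply: eq_bigr => b _.
by rewrite connection_formE// -scalemxAl.
Qed.

Lemma spinor_Cn i n : matrix_Cn (img i) 8 1 n (phi i).
Proof. by apply: of_Cn_matrix; exact: spinor_smooth. Qed.

Lemma has_cov_spinor i x v : img i x ->
  has_cov C (g i) (frame P i) v x (phi i) (nabla phi i x (v *m E i x)).
Proof.
move=> xi.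
have EF := coframe_frame (img i) _ _ (@frame_orthonormal _ _ _ _ _ P i) x xi.
rewrite /has_cov nablaE// -(mulmxA v) EF mulmx1.
by rewrite addrK; apply: (matrix_C1_is_derive (img i)) => //; exact: spinor_Cn.
Qed.

Lemma nabla_linear i x : img i x -> linear (nabla phi i x).
Proof.
move=> xi k X Y; rewrite !nablaE// mulmxDl -scalemxAl.
move: (X *m frame P i x) (Y *m frame P i x) => u v.
have dphi : differentiable (phi i) x.
  by apply: (matrix_C1_differentiable (img i)) => //; exact: spinor_Cn.
have dF : differentiable (frame P i) x.
  by apply: (matrix_C1_differentiable (img i)) => //; exact: frame_Cn.
have Alin : connection_mx (g i) (frame P i) (k *: u + v) x
    = k *: connection_mx (g i) (frame P i) u x + connection_mx (g i) (frame P i) v x.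
  rewrite /connection_mx derive_linearP// christoffel_mx_linearP mulmxDr -scalemxAr.
  by rewrite addrACA -scalerDr mulmxDl -scalemxAl.
rewrite derive_linearP// /spin Alin linearP/= scalerDr scalerA [_ * k]mulrC.
by rewrite -scalerA mulmxDl -scalemxAl addrACA scalerDr.
Qed.

Lemma nabla_sum i x X : img i x ->
  nabla phi i x X = \sum_a X 0 a *: nabla phi i x (delta_mx 0 a).
Proof.
move=> xi; pose L : {linear 'rV[R]_6 -> 'cV[R]_8} :=
  HB.pack (nabla phi i x) (GRing.isLinear.Build _ _ _ _ _ (nabla_linear i x xi)).
rewrite -[LHS]/(L X) {1}[X]row_sum_delta linear_sum.
by apply: eq_bigr => a _; rewrite linearZ.
Qed.

Lemma everywhere_iff (Q Q' : idx At -> 'rV[R]_6 -> Prop) :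
  (forall i x, img i x -> Q i x <-> Q' i x) -> everywhere Q <-> everywhere Q'.
Proof. by move=> QQ; split=> h i x xi; apply/QQ => //; exact: h. Qed.

Section Constants.
Variable J : endo_field At.
Hypotheses (M_connected : connected [set: M]) (phi_unit : unit_spinor phi)
  (J_phi : is_Jphi phi J).

Lemma mu_of_constant :
  everywhere (fun i x => forall X,
    nabla phi i x X = mu_of phi i x *: (cliff C X *m phi i x)) ->
  exists r, everywhere (fun i x => mu_of phi i x = r).
Proof.
move=> h.
apply: (mu_constant (P := P) (fun i => phi i) (mu_of phi) 1 J ltr01) => //.
- exact: spinor_Cn.
- exact: spinor_trans.
- by move=> i x X xi; exact: J_phi.
- by move=> i x v xi; rewrite /gam -h//; exact: has_cov_spinor.
Qed.

(* phi + j(phi) solves the equation nabla_X psi = - lambda X psi. *)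
Lemma lambda_of_constant :
  everywhere (fun i x => forall X,
    nabla phi i x X = - lambda_of phi i x *: (cliff C X *m jphi phi i x)) ->
  exists r, everywhere (fun i x => lambda_of phi i x = r).
Proof.
move=> h; pose psi i x := phi i x + volj C *m phi i x.
have cliffj (u : 'cV[R]_8) X : cliff C X *m (volj C *m u)
    = - (volj C *m (cliff C X *m u)).
  by rewrite !mulmxA volj_cliff mulNmx opprK.
have [r hr] : exists r, everywhere (fun i x => - lambda_of phi i x = r).
  (* The square norm of phi + j(phi) is 1 + 1, and -lambda takes the place of mu. *)
  apply: (mu_constant (P := P) psi (fun i x => - lambda_of phi i x) 2 J) => //.
  - move=> i n a b.
    have -> : (fun x => psi i x a b)
        = (fun x => phi i x a b + (volj C *m phi i x) a b).
      by apply/funext => x; rewrite mxE.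
    apply: scalar_CnD; first exact: spinor_Cn.
    by apply: matrix_Cn_mul; [exact: matrix_Cn_cst|exact: spinor_Cn].
  - move=> i k x ov; rewrite /psi (spinor_trans phi ov) mulmxDr !mulmxA.
        by rewrite (spin_group_volj C _ (lift_spin P ov)).
  - move=> i x xi; rewrite /psi ipDl !ipDr (ip_jphi_jphi C _ _ (phi_unit i x xi)).
    by rewrite (ipC (volj C *m _)) ip_phi_jphi addr0 add0r phi_unit.
  - by move=> i x X xi; rewrite /psi !mulmxDr !cliffj J_phi// mulmxN.
  (* As j is parallel and anticommutes with X, nabla_X j(phi) = -lambda j X j(phi) = -lambda X phi;
     adding -lambda X j(phi) gives -lambda X psi. *)
  - move=> i x v xi; have dphi := has_cov_spinor i x v xi.
    have := is_deriveD dphi (has_cov_volj C _ _ _ _ _ _ dphi).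
    congr is_derive; rewrite h// /gam /psi /jphi !cliffj mulmxDr cliffj.
    rewrite -!scalemxAr mulmxN (mulmxA (volj C) (volj C)) volj_sq mulNmx mul1mx opprK mulmxDr.
        rewrite addrACA -opprD -scalerDr; congr (_ *: _ - _); exact: addrC.
by exists (- r) => i x xi; rewrite -(hr i x xi) opprK.
Qed.

End Constants.
End SpinorDerivative.

Theorem theorem3p13 (R : realType) (C : clifford_module R)
    (M : topologicalType) (A : oriented_atlas R M) (g : riemannian_metric A)
    (P : spin_structure g C) (phi : spinor_field P) (J S : endo_field A)
    (M_connected : connected [set: M])
    (phi_unit : unit_spinor phi)
    (J_phi : is_Jphi phi J)
    (S_phi : is_Sphi phi S) :
  let cl := fun (X : 'rV[R]_6) (psi : 'cV[R]_8) => cliff C X *m psi in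
  let D := spin_dirac phi in
  let lam := lambda_of phi in
  let mu := mu_of phi in
  let nabla := nabla phi in
  let jphi := jphi phi in
  let eta := eta_of phi in
  let eta0 := fun i x => forall X, eta i x X = 0 in
  (of_class phi J S [:: chi1] <->
     (exists r : R, everywhere (fun i x => lam i x = r)) /\
     everywhere (fun i x => forall X,
       nabla i x X = - lam i x *: cl X (jphi i x))) /\
  (of_class phi J S [:: chi1b] <->
     (exists r : R, everywhere (fun i x => mu i x = r)) /\
     everywhere (fun i x => forall X,
       nabla i x X = mu i x *: cl X (phi i x))) /\
  (of_class phi J S [:: chi2] <-> everywhere (fun i x =>
     [/\ forall X Y, ip (cl (Y *m J i x) (nabla i x X)) (phi i x)
                     = - ip (cl Y (nabla i x (X *m J i x))) (phi i x),
         forall X Y, ip (cl Y (nabla i x X)) (jphi i x)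
                     = ip (cl X (nabla i x Y)) (jphi i x),
         lam i x = 0 & eta0 i x])) /\
  (of_class phi J S [:: chi2b] <-> everywhere (fun i x =>
     [/\ forall X Y, ip (cl (Y *m J i x) (nabla i x X)) (phi i x)
                     = - ip (cl Y (nabla i x (X *m J i x))) (phi i x),
         forall X Y, ip (cl Y (nabla i x X)) (jphi i x)
                     = - ip (cl X (nabla i x Y)) (jphi i x),
         mu i x = 0 & eta0 i x])) /\
  (of_class phi J S [:: chi3] <-> everywhere (fun i x =>
     [/\ forall X Y, ip (cl (Y *m J i x) (nabla i x X)) (phi i x)
                     = ip (cl Y (nabla i x (X *m J i x))) (phi i x),
         forall X Y, ip (cl Y (nabla i x X)) (jphi i x)
                     = ip (cl X (nabla i x Y)) (jphi i x)
       & eta0 i x])) /\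
  (of_class phi J S [:: chi4] <-> everywhere (fun i x =>
     [/\ forall X Y, ip (cl (Y *m J i x) (nabla i x X)) (phi i x)
                     = ip (cl Y (nabla i x (X *m J i x))) (phi i x),
         forall X Y, ip (cl Y (nabla i x X)) (jphi i x)
                     = - ip (cl X (nabla i x Y)) (jphi i x)
       & eta0 i x])) /\
  (of_class phi J S [:: chi5] <-> everywhere (fun i x => forall X,
     nabla i x X = ip (nabla i x X) (jphi i x) *: jphi i x)) /\
  (of_class phi J S [:: chi1; chi1b] <-> everywhere (fun i x => forall X,
     nabla i x X
       = - lam i x *: cl X (jphi i x) + mu i x *: cl X (phi i x))) /\
  (of_class phi J S [:: chi2; chi2b] <-> everywhere (fun i x =>
     [/\ forall X Y, ip (cl (Y *m J i x) (nabla i x X)) (phi i x)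
                     = - ip (cl Y (nabla i x (X *m J i x))) (phi i x),
         lam i x = 0, mu i x = 0 & eta0 i x])) /\
  (of_class phi J S [:: chi2; chi2b; chi5] <-> everywhere (fun i x =>
     [/\ forall X Y, ip (cl (Y *m J i x) (nabla i x X)) (phi i x)
                     = - ip (cl Y (nabla i x (X *m J i x))) (phi i x),
         lam i x = 0 & mu i x = 0])) /\
  (of_class phi J S [:: chi1; chi1b; chi2; chi2b] <-> everywhere (fun i x =>
     (forall X Y, ip (cl (Y *m J i x) (nabla i x X)) (phi i x)
                  = - ip (cl Y (nabla i x (X *m J i x))) (phi i x)) /\
     eta0 i x)) /\
  (of_class phi J S [:: chi1; chi1b; chi2; chi2b; chi5] <->
     everywhere (fun i x => forall X Y,
       ip (cl (Y *m J i x) (nabla i x X)) (phi i x)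
       = - ip (cl Y (nabla i x (X *m J i x))) (phi i x))) /\
  (of_class phi J S [:: chi2; chi2b; chi3] <-> everywhere (fun i x =>
     D i x = 0 /\ eta0 i x)) /\
  (of_class phi J S [:: chi1; chi1b; chi2; chi2b; chi3] <->
     everywhere (fun i x =>
       (forall X, ip (D i x) (cl X (phi i x)) = 0) /\ eta0 i x)) /\
  (of_class phi J S [:: chi1; chi1b; chi2; chi2b; chi3; chi4] <->
     everywhere (fun i x => forall X,
       ip (nabla i x X) (jphi i x) = 0)) /\
  (of_class phi J S [:: chi2; chi2b; chi3; chi5] <-> everywhere (fun i x =>
     [/\ forall X, ip (D i x) (cl X (jphi i x)) = eta i x X,
         lam i x = 0 & mu i x = 0])) /\
  (of_class phi J S [:: chi1; chi1b; chi2; chi2b; chi3; chi5] <->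
     everywhere (fun i x => forall X,
       ip (D i x) (cl X (jphi i x)) = eta i x X)) /\
  (of_class phi J S [:: chi3; chi4] <-> everywhere (fun i x =>
     (forall X Y, ip (cl (Y *m J i x) (nabla i x X)) (phi i x)
                  = ip (cl Y (nabla i x (X *m J i x))) (phi i x)) /\
     eta0 i x)) /\
  (of_class phi J S [:: chi3; chi4; chi5] <-> everywhere (fun i x =>
     forall X Y, ip (cl (Y *m J i x) (nabla i x X)) (phi i x)
                 = ip (cl Y (nabla i x (X *m J i x))) (phi i x))) /\
  (of_class phi J S [:: chi2; chi2b; chi3; chi4; chi5] <->
     everywhere (fun i x => lam i x = 0 /\ mu i x = 0)) /\
  (of_class phi J S [:: chi1b; chi2b; chi3] <-> everywhere (fun i x =>
     (forall X Y, ip (cl X (nabla i x Y)) (phi i x)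
                  = ip (cl Y (nabla i x X)) (phi i x)) /\
     eta0 i x)).
Proof.
move=> cl D lam mu nabla jphi eta eta0.
have pw i x (xi : img i x) := And4 (phi_unit i x xi) (J_phi i x xi) (S_phi i x xi)
  (fun X => nabla_sum phi i x X xi).
split.
  (* The class is first compared with the pointwise equation, lambda being a function; the constancy
     of lambda is then deduced from that equation. *)
  apply: (iff_trans (B := everywhere (fun i x => forall X,
      nabla i x X = - lam i x *: cl X (jphi i x)))).
    apply: everywhere_iff => i x /pw[h1 h2 h3 h4].
    exact: (chi1P C (phi i x) (J i x) (S i x) (nabla i x) h1 h2 h3 h4).
  by split=> [h|[]//]; split=> //; exact: (lambda_of_constant phi J).
split.
  apply: (iff_trans (B := everywhere (fun i x => forall X,
      nabla i x X = mu i x *: cl X (phi i x)))).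
    apply: everywhere_iff => i x /pw[h1 h2 h3 h4].
    exact: (chi1bP C (phi i x) (J i x) (S i x) (nabla i x) h1 h2 h3 h4).
  by split=> [h|[]//]; split=> //; exact: (mu_of_constant phi J).
split.
  apply: everywhere_iff => i x /pw[h1 h2 h3 h4].
  exact: (chi2P C (phi i x) (J i x) (S i x) (nabla i x) h1 h2 h3 h4).
split.
  apply: everywhere_iff => i x /pw[h1 h2 h3 h4].
  exact: (chi2bP C (phi i x) (J i x) (S i x) (nabla i x) h1 h2 h3 h4).
split.
  apply: everywhere_iff => i x /pw[h1 h2 h3 h4].
  exact: (chi3P C (phi i x) (J i x) (S i x) (nabla i x) h1 h2 h3 h4).
split.
  apply: everywhere_iff => i x /pw[h1 h2 h3 h4].
  exact: (chi4P C (phi i x) (J i x) (S i x) (nabla i x) h1 h2 h3 h4).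
split.
  apply: everywhere_iff => i x /pw[h1 h2 h3 h4].
  exact: (chi5P C (phi i x) (J i x) (S i x) (nabla i x) h1 h2 h3).
split.
  apply: everywhere_iff => i x /pw[h1 h2 h3 h4].
  exact: (chi11bP C (phi i x) (J i x) (S i x) (nabla i x) h1 h2 h3 h4).
split.
  apply: everywhere_iff => i x /pw[h1 h2 h3 h4].
  exact: (chi22bP C (phi i x) (J i x) (S i x) (nabla i x) h1 h2 h3 h4).
split.
  apply: everywhere_iff => i x /pw[h1 h2 h3 h4].
  exact: (chi22b5P C (phi i x) (J i x) (S i x) (nabla i x) h1 h2 h3).
split.
  apply: everywhere_iff => i x /pw[h1 h2 h3 h4].
  exact: (chi11b22bP C (phi i x) (J i x) (S i x) (nabla i x) h1 h2 h3 h4).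
split.
  apply: everywhere_iff => i x /pw[h1 h2 h3 h4].
  exact: (chi11b22b5P C (phi i x) (J i x) (S i x) (nabla i x) h1 h2 h3).
split.
  apply: everywhere_iff => i x /pw[h1 h2 h3 h4].
  exact: (chi22b3P C (phi i x) (J i x) (S i x) (nabla i x) h1 h2 h3 h4).
split.
  apply: everywhere_iff => i x /pw[h1 h2 h3 h4].
  exact: (chi11b22b3P C (phi i x) (J i x) (S i x) (nabla i x) h1 h2 h3 h4).
split.
  apply: everywhere_iff => i x /pw[h1 h2 h3 h4].
  exact: (chi11b22b34P C (phi i x) (J i x) (S i x) (nabla i x) h1 h2 h3 h4).
split.
  apply: everywhere_iff => i x /pw[h1 h2 h3 h4].
  exact: (chi22b35P C (phi i x) (J i x) (S i x) (nabla i x) h1 h2 h3 h4).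
split.
  apply: everywhere_iff => i x /pw[h1 h2 h3 h4].
  exact: (chi11b22b35P C (phi i x) (J i x) (S i x) (nabla i x) h1 h2 h3 h4).
split.
  apply: everywhere_iff => i x /pw[h1 h2 h3 h4].
  exact: (chi34P C (phi i x) (J i x) (S i x) (nabla i x) h1 h2 h3 h4).
split.
  apply: everywhere_iff => i x /pw[h1 h2 h3 h4].
  exact: (chi345P C (phi i x) (J i x) (S i x) (nabla i x) h1 h2 h3).
split.
  apply: everywhere_iff => i x /pw[h1 h2 h3 h4].
  exact: (chi22b345P C (phi i x) (J i x) (S i x) (nabla i x) h1 h2 h3).
apply: everywhere_iff => i x /pw[h1 h2 h3 h4].
exact: (chi1b2b3P C (phi i x) (J i x) (S i x) (nabla i x) h1 h2 h3 h4).
Qed.
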